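(* Assume (A1)–(A4) and fix $\delta>0$. For each $m\in\mathbb N$ let $\lambda^m_\delta$ be the constant of a solution $(w^m_\delta,\lambda^m_\delta)$ of the one-step equation (OS) on $B_m$ (such solutions exist, and $\lambda^m_\delta$ equals the optimal value of the dyadic impulse control problem with obligatory impulses outside $B_m$, hence is uniquely determined and non-decreasing in $m$), and set $\lambda_\delta:=\lim_{m\to\infty}\lambda^m_\delta$. If $\lambda_\delta>r(f)$, then there exists $w_\delta\in\mathcal C_b(E)$ with $\sup_{\xi\in U}w_\delta(\xi)=0$ such that \[ w_\delta(x)=\sup_{\tau\in\mathcal T^\delta_{x,b}}\ln\mathbb E_x\Big[e^{\int_0^\tau(f(X_s)-\lambda_\delta)ds+Mw_\delta(X_\tau)}\Big],\qquad x\in E. \]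
   Context: Setting: $X$ is a standard Feller–Markov process with values in a locally compact separable metric space $(E,\rho)$ with Borel $\sigma$-field $\mathcal E$; laws $\mathbb P_x$, expectations $\mathbb E_x$, $P_t(x,A)=\mathbb P_x[X_t\in A]$. $\mathcal C_b(E)$: bounded continuous functions. $\mathcal T^\delta_{x,b}$: $\mathbb P_x$-a.s. bounded stopping times with values in $\{0,\delta,2\delta,\dots\}\cup\{\infty\}$. $U\subseteq E$ compact; $(B_m)$ compact, $U\subset B_0$, $B_m\subset B_{m+1}$, $\bigcup B_m=E$. $Mh(x):=\sup_{\xi\in U}(c(x,\xi)+h(\xi))$. $r(f):=\lim_{t\to\infty}\frac1t\ln\sup_{x\in E}\mathbb E_x[e^{\int_0^tf(X_s)ds}]$. $\tau_{B_m}:=\delta\inf\{k\in\mathbb N:X_{k\delta}\notin B_m\}$. (OS) on $B_m$: $\lambda^m_\delta\in\mathbb R$, $w^m_\delta$ bounded continuous on $B_m$, $w^m_\delta=Mw^m_\delta$ off $B_m$, and for $x\in B_m$: $w^m_\delta(x)=\max\big(\ln\mathbb E_x[e^{\int_0^\delta(f(X_s)-\lambda^m_\delta)ds+1_{\{X_\delta\in B_m\}}w^m_\delta(X_\delta)+1_{\{X_\delta\notin B_m\}}Mw^m_\delta(X_\delta)}],\ Mw^m_\delta(x)\big)$. Standing assumptions: (A1) $f:E\to(-\infty,0]$ is continuous and bounded; $c:E\times U\to(-\infty,0]$ is continuous, bounded, and for some $c_0<0$: $0>c_0\ge c(x,\xi)\ge c(x,\eta)+c(\eta,\xi)$ for all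 $x\in E$, $\xi,\eta\in U$; moreover $\sup_{\xi\in U}|c(x,\xi)-c(y,\xi)|\to0$ as $x,y$ both tend to infinity (leave every compact set). (A2) For every $t>0$ and $x_n\to x$: $\sup_{A\in\mathcal E}|P_t(x_n,A)-P_t(x,A)|\to0$. (A3) For every compact $\Gamma\subset E$, $t_0>0$, $r_0>0$: $\lim_{r\to\infty}M_\Gamma(t_0,r)=0$ and $\lim_{t\to0}M_\Gamma(t,r_0)=0$, where $M_\Gamma(t,r):=\sup_{x\in\Gamma}\mathbb P_x[\sup_{s\in[0,t]}\rho(X_s,x)\ge r]$. (A4) For every $m$, $x\in B_m$, $\delta>0$ and open $\mathcal O\subset B_m$: $\mathbb P_x[\bigcup_{i\ge1}\{X_{i\delta}\in\mathcal O\}]=1$; and for all $x\in E$, $\delta>0$, $m$: $\mathbb P_x[\tau_{B_m}<\infty]=1$. *)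

(* Defs.v *)
From HB Require Import structures.
From mathcomp Require Import all_boot all_order all_algebra.
From mathcomp Require Import all_classical all_reals all_analysis.
Set Implicit Arguments. Unset Strict Implicit. Unset Printing Implicit Defensive.
Import Order.TTheory GRing.Theory Num.Theory.
Import numFieldNormedType.Exports.
Local Open Scope classical_set_scope.
Local Open Scope ring_scope.

Section Space.
Context {R : realType} {E : topologicalType}.

Definition borelE : set (set E) := <<s [set A : set E | open A] >>.

Definition bounded_on (A : set E) (g : E -> R) : Prop :=
  exists K : R, forall x, A x -> `|g x| <= K.

Definition Cb (g : E -> R) : Prop := continuous g /\ bounded_on setT g.

Definition metric_inducing (rho : E -> E -> R) : Prop :=
  (forall x y, 0 <= rho x y) /\ (forall x y, rho x y = 0 <-> x = y) /\
  (forall x y, rho x y = rho y x) /\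
  (forall x y z, rho x z <= rho x y + rho y z) /\
  (forall A : set E, open A <->
     forall x, A x -> exists e : R, 0 < e /\ [set y | rho x y < e] `<=` A).

Definition locally_compact_space : Prop :=
  forall x : E, exists K : set E, compact K /\ nbhs x K.

Definition separable_space : Prop :=
  exists D : set E, countable D /\
    forall O : set E, open O -> O !=set0 -> O `&` D !=set0.

Definition Mop (U : set E) (c : E -> E -> R) (h : E -> R) (x : E) : R :=
  sup [set c x xi + h xi | xi in U].

Definition A1 (f : E -> R) (U : set E) (c : E -> E -> R) : Prop :=
  [/\ [/\ continuous f, bounded_on setT f & (forall x, f x <= 0)],
      {within [set p : E * E | U p.2], continuous (fun p => c p.1 p.2)},
      (exists K : R, forall x xi, U xi -> `|c x xi| <= K) &
      [/\ (forall x xi, U xi -> c x xi <= 0),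
          (exists c0 : R, c0 < 0 /\ forall x xi eta, U xi -> U eta ->
              c x xi <= c0 /\ c x eta + c eta xi <= c x xi) &
          (forall eps : R, 0 < eps -> exists K : set E, compact K /\
              forall x y, ~ K x -> ~ K y -> forall xi, U xi ->
                `|c x xi - c y xi| <= eps)]].

End Space.

Section Process.
Context {R : realType} {E : topologicalType} {d : measure_display}
  {Omega : measurableType d}.
Variables (P : E -> probability Omega R) (F : R -> set (set Omega))
  (X : R -> Omega -> E).

Definition Ex (x : E) (Y : Omega -> R) : \bar R := (\int[P x]_w (Y w)%:E)%E.

Definition Pt (t : R) (x : E) (A : set E) : \bar R := P x (X t @^-1` A).

Definition is_filtration : Prop :=
  (forall t, 0 <= t -> sigma_algebra setT (F t) /\ F t `<=` measurable) /\
  (forall s t, 0 <= s -> s <= t -> F s `<=` F t).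

Definition adapted : Prop :=
  forall t, 0 <= t -> forall B, borelE B -> F t (X t @^-1` B).

Definition stopping_time (T : Omega -> \bar R) : Prop :=
  (forall w, (0 <= T w)%E) /\
  forall t, 0 <= t -> F t [set w | (T w <= t%:E)%E].

Definition in_F_T (T : Omega -> \bar R) (A : set Omega) : Prop :=
  measurable A /\ forall t, 0 <= t -> F t (A `&` [set w | (T w <= t%:E)%E]).

Definition cadlag_paths : Prop :=
  forall w t, 0 <= t ->
    (X s w @[s --> t^'+] --> X t w) /\
    (0 < t -> exists l : E, X s w @[s --> t^'-] --> l).

Definition normal_process : Prop :=
  forall x, P x [set w | X 0 w = x] = 1%E.

Definition measurable_kernel : Prop :=
  forall t, 0 <= t -> forall B, borelE B -> forall V : set R, measurable V ->
    borelE ((fun x => fine (Pt t x B)) @^-1` V).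

Definition strong_Markov : Prop :=
  forall T, stopping_time T -> forall A, in_F_T T A ->
  forall s, 0 <= s -> forall B, borelE B -> forall x,
    P x (A `&` [set w | (T w < +oo)%E /\ B (X (fine (T w) + s) w)]) =
    (\int[P x]_(w in A `&` [set w | (T w < +oo)%E]) Pt s (X (fine (T w)) w) B)%E.

Definition quasi_left_continuous : Prop :=
  forall (Tn : nat -> Omega -> \bar R) (T : Omega -> \bar R),
    (forall n, stopping_time (Tn n)) -> stopping_time T ->
    (forall w, {homo (fun n => Tn n w) : m n / (m <= n)%N >-> (m <= n)%E}) ->
    (forall w, Tn n w @[n --> \oo] --> T w) ->
    forall x, (P x).-negligible
      [set w | (T w < +oo)%E /\
               ~ (X (fine (Tn n w)) w @[n --> \oo] --> X (fine (T w)) w)].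

Definition Feller : Prop :=
  forall t, 0 <= t -> forall g : E -> R, Cb g ->
    continuous (fun x => fine (Ex x (fun w => g (X t w)))).

Definition standard_Feller_Markov : Prop :=
  [/\ [/\ is_filtration, adapted & cadlag_paths], normal_process,
      measurable_kernel & [/\ strong_Markov, quasi_left_continuous & Feller]].

Definition pathint (g : E -> R) (t : R) (w : Omega) : R :=
  Rintegral (@lebesgue_measure R) `[0%R, t]%classic (fun s => g (X s w)).

Definition A2 : Prop :=
  forall t, 0 < t -> forall (xn : nat -> E) (x : E), xn n @[n --> \oo] --> x ->
  forall eps : R, 0 < eps -> \forall n \near \oo,
    forall A, borelE A -> `|fine (Pt t (xn n) A) - fine (Pt t x A)| <= eps.

Definition MGamma (rho : E -> E -> R) (Gamma : set E) (t r : R) : \bar R :=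
  ereal_sup [set P x [set w | (r%:E <=
      ereal_sup [set (rho (X s w) x)%:E | s in `[0%R, t]%classic])%E] | x in Gamma].

Definition A3 (rho : E -> E -> R) : Prop :=
  forall Gamma : set E, compact Gamma -> Gamma !=set0 ->
    (forall t0 : R, 0 < t0 -> MGamma rho Gamma t0 r @[r --> +oo] --> 0%E) /\
    (forall r0 : R, 0 < r0 -> MGamma rho Gamma t r0 @[t --> 0^'+] --> 0%E).

Definition A4 (B : nat -> set E) : Prop :=
  (forall m x (delta : R) (O : set E), B m x -> 0 < delta -> open O ->
     O !=set0 -> O `<=` B m ->
     P x [set w | exists i : nat, (0 < i)%N /\ O (X (i%:R * delta) w)] = 1%E) /\
  (forall x (delta : R) m, 0 < delta ->
     P x [set w | exists k : nat, ~ B m (X (k%:R * delta) w)] = 1%E).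

(* tau in T^delta_{x,b}: tau w = Some k means tau = k delta, None means +oo *)
Definition dyadic_stopping (delta : R) (x : E) (tau : Omega -> option nat) : Prop :=
  (forall k : nat, F (k%:R * delta) [set w | tau w = Some k]) /\
  exists N : nat,
    P x [set w | exists k, tau w = Some k /\ (k <= N)%N] = 1%E.

Definition stopped_payoff (delta lam : R) (f : E -> R) (U : set E)
  (c : E -> E -> R) (h : E -> R) (tau : Omega -> option nat) (w : Omega) : R :=
  match tau w with
  | Some k => expR (pathint (fun y => f y - lam) (k%:R * delta) w
                    + Mop U c h (X (k%:R * delta) w))
  | None => 0
  end.

Definition OS_solution (delta : R) (f : E -> R) (U : set E) (c : E -> E -> R)
  (Bm : set E) (w : E -> R) (lam : R) : Prop :=
  [/\ {within Bm, continuous w}, bounded_on Bm w,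
      (forall x, ~ Bm x -> w x = Mop U c w x) &
      (forall x, Bm x -> w x = Num.max
         (ln (fine (Ex x (fun om =>
            expR (pathint (fun y => f y - lam) delta om
                  + \1_Bm (X delta om) * w (X delta om)
                  + \1_(~` Bm) (X delta om) * Mop U c w (X delta om))))))
         (Mop U c w x))].

Definition rf (f : E -> R) : R :=
  lim ((t^-1 * ln (sup [set fine (Ex x (fun w => expR (pathint f t w))) | x in setT]))
         @[t --> +oo]).

End Process.

(* Main.v *)
Require Import Defs.
From HB Require Import structures.
From mathcomp Require Import all_boot all_order all_algebra.
From mathcomp Require Import all_classical all_reals all_analysis.
From mathcomp Require Import measurable_realfun ring lra.
Set Implicit Arguments. Unset Strict Implicit. Unset Printing Implicit Defensive.
Import Order.TTheory GRing.Theory Num.Theory.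
Import numFieldNormedType.Exports.
Local Open Scope classical_set_scope.
Local Open Scope ring_scope.

(** Put v = exp w, Q h (x) = E_x[exp(int_0^delta f) h(X_delta)] and
    M w (x) = sup_U (c(x, .) + w).  A solution of the one-step equation on B_m
    satisfies v = max(e^{-lam delta} Q v, e^{M w}) on B_m and w = M w outside.
    Comparing the solutions on B_m and B_{m+1} (and with the constant 1) shows
    that lam m is nondecreasing and nonpositive, so it has a limit L.

    Normalise the solutions w_m by sup_U w_m = 0.  The functions M w_m inherit
    the modulus of continuity of c, also at infinity, so they converge uniformly
    along an ultrafilter to some G.  Because r(f) < L, the powers of
    e^{-lam m0 delta} Q tend to 0 uniformly for some m0.  Hence
    v = max(e^{-L delta} Q v, e^G) has a bounded solution, which is continuous
    because Q is strong Feller by (A2), and v_m -> v uniformly on the compact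
    set U: the error caused by the obligatory impulses outside B_m is carried
    by Q^k 1_{~ B_m}, which tends to 0 by Dini's theorem.  Passing to the limit,
    G = M (ln v) and sup_U ln v = 0.

    Finally v is the value of the optimal stopping problem with reward e^G:
    Y_k v(X_{k delta}), with Y_k the discount, is a supermartingale, and a
    martingale up to the first time v <= e^G; truncating this time at N costs
    at most a multiple of (e^{-L delta} Q)^N 1. *)

(** * Bounded measurable functions and their means *)

(** Since L <= 0, the factor e^{-L delta} is at least 1, while Q is merely a contraction for the sup
    norm. So the obstacle equation is not a contraction, and only a power of e^{-lam m0 delta} Q can
    be made small; this is where the strict gap between r(f) and L is spent. The index m0 is frozen
    because one constant must bound v and all v_m with m >= m0 at once, before any limit is taken.
    The limit is organised around the fact that M reads its argument only on U. The obstacles M w_m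
    live on all of E but vary with x only through c, which gives compactness. The v_m are compared
    with v only on U, where the region outside B_m is felt through Q^k alone. The limit obstacle G
    is at first just some limit of the M w_m; its relation to v is recovered afterwards. Path
    weights are handled through Riemann sums: right-continuity of the paths makes them converge, and
    they reduce the Markov property of the weighted semigroup to repeated use of the Markov property
    at single times. *)

(* measurableType requires a distinguished point, hence the parameter e0. *)
Definition borel_space (E : topologicalType) (e0 : E) : Type := E.

Section BorelSpace.
Context (E : topologicalType) (e0 : E).

HB.instance Definition _ := Choice.on (borel_space e0).
HB.instance Definition _ := isPointed.Build (borel_space e0) e0.

Lemma borelE0 : @borelE E set0. Proof. exact: sigma_algebra0. Qed.

Lemma borelEC (A : set E) : borelE A -> borelE (~` A).
Proof. by move=> bA; rewrite -setTD; exact: sigma_algebraCD. Qed.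

Lemma borelE_bigcup (A : (set E)^nat) :
  (forall i, borelE (A i)) -> borelE (\bigcup_i A i).
Proof. exact: sigma_algebra_bigcup. Qed.

HB.instance Definition _ := @isMeasurable.Build default_measure_display
  (borel_space e0) (@borelE E) borelE0 borelEC borelE_bigcup.

Lemma open_borelE (A : set E) : open A -> borelE A.
Proof. exact: sub_sigma_algebra. Qed.

Lemma closed_borelE (A : set E) : closed A -> borelE A.
Proof.
move=> cA; rewrite -(setCK A); apply: borelEC; apply: open_borelE.
exact: closed_openC.
Qed.

End BorelSpace.

Section BoundedMeasurable.
Context {d : measure_display} {T : measurableType d} {R : realType}.
Implicit Types (Z Y : T -> R) (A : set T).

(** Boundedness gives integrability under every probability at once, so one predicate serves all the
    laws [P x] and the computations stay in the reals. *)
Definition bmeas Z := measurable_fun setT Z /\ exists K, forall w, `|Z w| <= K.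

Lemma bmeas_cst (a : R) : bmeas (fun=> a).
Proof. by split=> //; exists `|a|. Qed.

Lemma bmeasD Z Y : bmeas Z -> bmeas Y -> bmeas (fun w => Z w + Y w).
Proof.
move=> [mZ [K ZK]] [mY [L YL]]; split; first exact: measurable_funD.
by exists (K + L) => w; rewrite (le_trans (ler_normD _ _))// lerD.
Qed.

Lemma bmeasM Z Y : bmeas Z -> bmeas Y -> bmeas (fun w => Z w * Y w).
Proof.
move=> [mZ [K ZK]] [mY [L YL]]; split; first exact: measurable_funM.
by exists (K * L) => w; rewrite normrM ler_pM.
Qed.

Lemma bmeasZ (a : R) Z : bmeas Z -> bmeas (fun w => a * Z w).
Proof. by move=> bZ; apply: bmeasM => //; exact: bmeas_cst. Qed.

Lemma bmeasN Z : bmeas Z -> bmeas (fun w => - Z w).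
Proof.
move=> /(bmeasZ (-1)); congr bmeas; apply/funext => w.
by rewrite mulN1r.
Qed.

Lemma bmeasB Z Y : bmeas Z -> bmeas Y -> bmeas (fun w => Z w - Y w).
Proof. by move=> bZ /bmeasN bY; exact: bmeasD. Qed.

Lemma bmeas_sum (I : Type) (s : seq I) (p : pred I) (Z : I -> T -> R) :
  (forall i, bmeas (Z i)) -> bmeas (fun w => \sum_(i <- s | p i) Z i w).
Proof.
move=> bZ; elim: s => [|i s IH].
  by under eq_fun do rewrite big_nil; exact: bmeas_cst.
under eq_fun do rewrite big_cons.
by case: (p i) => //; exact: bmeasD.
Qed.

Lemma bmeas_max Z Y : bmeas Z -> bmeas Y -> bmeas (fun w => Num.max (Z w) (Y w)).
Proof.
move=> [mZ [K ZK]] [mY [L YL]]; split; first exact: measurable_maxr.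
exists (Num.max K L) => w; case: (lerP (Z w) (Y w)) => _.
  by rewrite le_max YL orbT.
by rewrite le_max ZK.
Qed.

Lemma bmeas_norm Z : bmeas Z -> bmeas (fun w => `|Z w|).
Proof.
move=> [mZ [K ZK]]; split; first exact: measurableT_comp.
by exists K => w; rewrite normr_id.
Qed.

Lemma bmeas_expR Z : bmeas Z -> bmeas (fun w => expR (Z w)).
Proof.
move=> [mZ [K ZK]]; split; first exact: measurableT_comp.
exists (expR K) => w; rewrite ger0_norm ?expR_ge0// ler_expR.
exact: le_trans (ler_norm _) (ZK w).
Qed.

Lemma bmeas_indic A : measurable A -> bmeas \1_A.
Proof.
move=> mA; split; first exact: measurable_indic.
by exists 1 => w; rewrite indicE; case: (_ \in _); rewrite ?normr1 ?normr0.
Qed.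

Lemma bmeas_cvg (Zn : nat -> T -> R) Z K :
  (forall n, bmeas (Zn n)) -> (forall n w, `|Zn n w| <= K) ->
  (forall w, Zn n w @[n --> \oo] --> Z w) -> bmeas Z.
Proof.
move=> bZ ZK cZ; split.
  apply: (measurable_fun_cvg (h := Zn)) => [n|w _]; [by have [] := bZ n|exact: cZ].
exists K => w; apply: cvgr_to_le (cvg_norm (cZ w)) _.
exact: nearW.
Qed.

End BoundedMeasurable.

Section Mean.
Context {d : measure_display} {T : measurableType d} {R : realType}.
Variable mu : probability T R.
Implicit Types (Z Y : T -> R) (A : set T).

Definition mean Z : R := \int[mu]_w Z w.

Lemma bmeas_integrable Z : bmeas Z -> mu.-integrable setT (EFin \o Z).
Proof.
move=> [mZ [K ZK]].
have iK := finite_measure_integrable_cst mu `|K| (@measurableT _ T).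
apply: le_integrable iK; [by []|exact/measurable_EFinP|].
by move=> w _; rewrite lee_fin normr_id (le_trans (ZK w))// ler_norm.
Qed.

Lemma mean_cst a : mean (fun=> a) = a.
Proof.
by rewrite /mean Rintegral_cst//= probability_setT mulr1.
Qed.

Lemma meanD Z Y : bmeas Z -> bmeas Y -> mean (fun w => Z w + Y w) = mean Z + mean Y.
Proof. by move=> bZ bY; apply: RintegralD => //; exact: bmeas_integrable. Qed.

Lemma meanB Z Y : bmeas Z -> bmeas Y -> mean (fun w => Z w - Y w) = mean Z - mean Y.
Proof. by move=> bZ bY; apply: RintegralB => //; exact: bmeas_integrable. Qed.

Lemma meanZ a Z : bmeas Z -> mean (fun w => a * Z w) = a * mean Z.
Proof. by move=> bZ; apply: RintegralZl => //; exact: bmeas_integrable. Qed.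

Lemma mean_sum (I : Type) (s : seq I) (p : pred I) (Z : I -> T -> R) :
  (forall i, bmeas (Z i)) ->
  mean (fun w => \sum_(i <- s | p i) Z i w) = \sum_(i <- s | p i) mean (Z i).
Proof.
move=> bZ; elim: s => [|i s IH].
  by under eq_fun do rewrite big_nil; rewrite big_nil mean_cst.
under eq_fun do rewrite big_cons.
rewrite big_cons; case: (p i) => //.
by rewrite meanD ?IH//; exact: bmeas_sum.
Qed.

Lemma le_mean Z Y : bmeas Z -> bmeas Y -> (forall w, Z w <= Y w) -> mean Z <= mean Y.
Proof. by move=> bZ bY ZY; apply: le_Rintegral => //; exact: bmeas_integrable. Qed.

Lemma mean_ge0 Z : (forall w, 0 <= Z w) -> 0 <= mean Z.
Proof. by move=> Z0; apply: Rintegral_ge0 => w _. Qed.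

Lemma le_mean_norm Z Y : bmeas Z -> bmeas Y -> (forall w, `|Z w| <= Y w) ->
  `|mean Z| <= mean Y.
Proof.
move=> bZ bY ZY.
apply: le_trans (le_normr_Rintegral _ (bmeas_integrable bZ)) _ => //.
apply: le_Rintegral => //; last exact: bmeas_integrable.
exact: (bmeas_integrable (bmeas_norm bZ)).
Qed.

Lemma mean_norm_le Z K : bmeas Z -> (forall w, `|Z w| <= K) -> `|mean Z| <= K.
Proof.
by move=> bZ ZK; rewrite -[leRHS]mean_cst; apply: le_mean_norm => //; exact: bmeas_cst.
Qed.

Lemma mean_indic A : measurable A -> mean \1_A = fine (mu A).
Proof. by move=> mA; rewrite /mean /Rintegral integral_indic// setIT. Qed.

Lemma mean_cvg (Zn : nat -> T -> R) Z K :
  (forall n, bmeas (Zn n)) -> (forall n w, `|Zn n w| <= K) ->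
  (forall w, Zn n w @[n --> \oo] --> Z w) -> mean (Zn n) @[n --> \oo] --> mean Z.
Proof.
move=> bZ ZK cZ.
apply: fine_cvg; rewrite fineK; last first.
  exact: integrable_fin_num (bmeas_integrable (bmeas_cvg bZ ZK cZ)).
apply: (@dominated_cvg _ _ _ mu setT _ (fun n w => (Zn n w)%:E) _ (cst K%:E)) => //.
- by move=> n; apply/measurable_EFinP; have [] := bZ n.
- by move=> w _; apply: cvg_EFin; [exact: nearW|exact: cZ].
- exact: (finite_measure_integrable_cst mu K).
- by move=> n w _ /=; rewrite lee_fin ZK.
Qed.

Lemma eq_mean_prob1 Z Y A : measurable A -> mu A = 1%E ->
  measurable_fun setT Z -> measurable_fun setT Y ->
  (forall w, A w -> Z w = Y w) -> mean Z = mean Y.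
Proof.
move=> mA A1 mZ mY ZY; congr fine; apply: ae_eq_integral => //.
- exact/measurable_EFinP.
- exact/measurable_EFinP.
- exists (~` A); split; first exact: measurableC.
    by apply: etrans (probability_setC mu mA) _; rewrite A1 subee.
  by move=> w; apply: contra_not => Aw _ /=; rewrite ZY.
Qed.

End Mean.

(** * Layer-cake approximation by averages of indicators *)

Section LayerCake.
Context {R : realType}.

(** The sum counts the positive integers not exceeding y, so it is the floor of y. Peeling off the
    first level replaces y by y - 1. *)
Lemma sum_levels (n : nat) (y : R) : 0 <= y <= n%:R ->
  y - 1 <= \sum_(j < n) (j.+1%:R <= y)%R%:R <= y.
Proof.
elim: n y => [|n IH] y /andP[y0 yn].
  by rewrite big_ord0 y0 andbT; lra.
rewrite big_ord_recl; have [y1|y1] := leP 1 y.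
  rewrite mulr1n.
  have /IH : 0 <= y - 1 <= n%:R.
    by rewrite subr_ge0 y1 lerBlDr natr1.
  have -> : \sum_(j < n) (j.+1%:R <= y - 1)%R%:R =
      \sum_(j < n) ((lift ord0 j).+1%:R <= y)%R%:R :> R.
    by apply: eq_bigr => j _; rewrite lift0 -[in RHS]natr1 lerBrDr.
  by set S := (\sum_(_ < _) _) => /andP[S1 S2]; apply/andP; split; lra.
rewrite mulr0n add0r.
rewrite big1 => [|j _]; last first.
  by rewrite leNgt (lt_le_trans y1)// ler1n.
by apply/andP; split; lra.
Qed.

Context {d : measure_display} {T : measurableType d}.

(** For 0 <= Z <= 1 this is floor((n+1) Z) / (n+1), written as an average of n+1 indicators. The
    coefficients sum to 1, so a common bound on differences of probabilities passes to the means
    without loss. *)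
Definition levels (n : nat) (Z : T -> R) (w : T) : R :=
  n.+1%:R^-1 * \sum_(j < n.+1) \1_[set w | j.+1%:R <= n.+1%:R * Z w] w.

Lemma levels_dist (n : nat) (Z : T -> R) (w : T) : 0 <= Z w <= 1 ->
  `|levels n Z w - Z w| <= n.+1%:R^-1.
Proof.
move=> /andP[Z0 Z1].
have n0 : 0 < n.+1%:R :> R by rewrite ltr0n.
have /sum_levels : 0 <= n.+1%:R * Z w <= n.+1%:R.
  by rewrite mulr_ge0 ?ler0n//= ler_piMr ?ler0n.
have -> : \sum_(j < n.+1) (j.+1%:R <= n.+1%:R * Z w)%R%:R =
    \sum_(j < n.+1) \1_[set w | j.+1%:R <= n.+1%:R * Z w] w :> R.
  by apply: eq_bigr => j _; rewrite indicE mem_setE.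
rewrite /levels; set S := \sum_(_ < _) _ => /andP[S1 S2].
rewrite -(ler_pM2l n0) mulfV ?lt0r_neq0// -[X in X * _](gtr0_norm n0) -normrM.
rewrite mulrBr mulVKf ?lt0r_neq0// ler_norml; apply/andP; split; lra.
Qed.

End LayerCake.

Section LayerCakeConsequences.
Context {R : realType} {d : measure_display} {T : measurableType d}.

Lemma measurable_superlevel (Z : T -> R) (a b : R) :
  measurable_fun setT Z -> measurable [set w | a <= b * Z w].
Proof.
move=> mZ; have mbZ : measurable_fun setT (fun w => b * Z w).
  exact: measurable_funM.
have := mbZ measurableT `[a, +oo[%classic (measurable_itv _).
by rewrite setTI; congr measurable; apply/seteqP; split=> w /=;
  rewrite in_itv/= andbT.
Qed.

Lemma bmeas_levels n (Z : T -> R) : measurable_fun setT Z -> bmeas (levels n Z).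
Proof.
move=> mZ; apply: bmeasZ; apply: bmeas_sum => j; apply: bmeas_indic.
exact: measurable_superlevel.
Qed.

Lemma invS_cvg0 : (n.+1%:R : R)^-1 @[n --> \oo] --> (0 : R).
Proof. exact: cvg_harmonic. Qed.

Lemma levels_cvg (Z : T -> R) w : 0 <= Z w <= 1 ->
  levels n Z w @[n --> \oo] --> Z w.
Proof.
move=> Z01; apply/cvgrPdist_le => e e0.
have := invS_cvg0 => /cvgrPdist_le /(_ _ e0); apply: filterS => n.
rewrite sub0r normrN ger0_norm ?invr_ge0// => ne.
by rewrite distrC (le_trans (levels_dist _ Z01)).
Qed.

Lemma bmeas_normalize (Z : T -> R) : bmeas Z -> exists K Y,
  [/\ 0 < K, bmeas Y, (forall w, 0 <= Y w <= 1) &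
    Z = (fun w => (2 * K) * Y w + - K)].
Proof.
move=> bZ; have [mZ [L ZL]] := bZ.
pose K := `|L| + 1; have K0 : 0 < K by rewrite ltr_wpDl.
have ZK w : `|Z w| <= K.
  by rewrite (le_trans (ZL w))// (le_trans (ler_norm _))// lerDl.
exists K, (fun w => (2 * K)^-1 * (Z w + K)); split => //.
- by apply: bmeasZ; apply: bmeasD => //; exact: bmeas_cst.
- move=> w; have := ZK w; rewrite ler_norml => /andP[h1 h2].
  rewrite mulr_ge0/= ?invr_ge0; [|lra|lra].
  by rewrite mulrC ler_pdivrMr; lra.
- by apply/funext => w; rewrite mulVKf ?addrK// mulf_neq0// lt0r_neq0.
Qed.

(* Monotone-class principle: a layer-cake sum of indicators converges
   uniformly, so no closure under monotone limits is needed. *)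
Lemma bmeas_ind (Pr : (T -> R) -> Prop) :
  (forall A, measurable A -> Pr \1_A) ->
  (forall a Z Y, bmeas Z -> bmeas Y -> Pr Z -> Pr Y ->
     Pr (fun w => a * Z w + Y w)) ->
  (forall (Zn : nat -> T -> R) Z K, (forall n, bmeas (Zn n)) ->
     (forall n, Pr (Zn n)) -> (forall n w, `|Zn n w| <= K) ->
     (forall w, Zn n w @[n --> \oo] --> Z w) -> Pr Z) ->
  forall Z, bmeas Z -> Pr Z.
Proof.
move=> Hi Hl Hc Z bZ.
have H0 : Pr (fun=> 0).
  by rewrite -[X in Pr X]/(cst 0) -indic0; exact: Hi.
have HC a : Pr (fun=> a).
  have := Hl a \1_setT _ (bmeas_indic measurableT) (bmeas_cst 0) (Hi _ measurableT) H0.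
  by congr Pr; apply/funext => w; rewrite indicT mulr1 addr0.
have Hs n (A : nat -> set T) : (forall i, measurable (A i)) ->
    Pr (fun w => \sum_(j < n) \1_(A j) w).
  move=> mA; elim: n => [|n IH].
    by under eq_fun do rewrite big_ord0.
  under eq_fun do rewrite big_ord_recr/= addrC -[X in X + _]mul1r.
  apply: (Hl 1 \1_(A n)) => //; [exact: bmeas_indic|apply: bmeas_sum => j|].
    exact: bmeas_indic.
  exact: Hi.
have [K [Y [K0 bY Y01 ->]]] := bmeas_normalize bZ.
apply: (Hl (2 * K) Y (fun=> - K)) => //; first exact: bmeas_cst.
have [mY _] := bY.
(* The bound 2 is the sum of the bound 1 on [Y] and an approximation error of at most 1. *)
apply: (Hc (fun n => levels n Y) Y 2) => [n|n|n w|w].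
- exact: bmeas_levels.
- have -> : levels n Y = (fun w => n.+1%:R^-1 *
      (\sum_(j < n.+1) \1_[set w | j.+1%:R <= n.+1%:R * Y w] w) + 0).
    by apply/funext => w; rewrite addr0.
  apply: (Hl _ (fun w => \sum_(j < n.+1) _) (fun=> 0)) => //; last first.
  - by apply: (Hs n.+1 (fun j => [set w | j.+1%:R <= n.+1%:R * Y w])) => j;
      exact: measurable_superlevel.
  - exact: bmeas_cst.
  - apply: bmeas_sum => j; apply: bmeas_indic; exact: measurable_superlevel.
- have := levels_dist n (Y01 w); have := Y01 w => /andP[y0 y1].
  have : n.+1%:R^-1 <= 1 :> R by rewrite invf_le1// ler1n.
  move: (levels n Y w) (n.+1%:R^-1) => a b b1.
  rewrite !ler_norml => /andP[h1 h2]; apply/andP; split; lra.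
- exact: levels_cvg.
Qed.

End LayerCakeConsequences.

(** * From total variation to differences of means *)

Section TotalVariation.
Context {R : realType} {d d' : measure_display}
  {T : measurableType d} {T' : measurableType d'}.

(** Rescaling [h] to [0, 1] produces the factor 2 K. Each superlevel set contributes at most [e],
    the layer-cake average keeps this bound, and so does the limit. *)
Lemma mean_dist (mu nu : probability T R) (X : T -> T') (h : T' -> R) (K e : R) :
  measurable_fun setT X -> 0 < K -> measurable_fun setT h ->
  (forall y, `|h y| <= K) ->
  (forall A, measurable A ->
    `|fine (mu (X @^-1` A)) - fine (nu (X @^-1` A))| <= e) ->
  `|mean mu (h \o X) - mean nu (h \o X)| <= 2 * K * e.
Proof.
move=> mX K0 mh hK He.
pose Y := fun y => (2 * K)^-1 * (h y + K).
have mY : measurable_fun setT Y.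
  by apply: measurable_funM => //; exact: measurable_funD.
have Y01 y : 0 <= Y y <= 1.
  have := hK y; rewrite ler_norml => /andP[h1 h2].
  rewrite mulr_ge0/= ?invr_ge0; [|lra|lra].
  by rewrite /Y mulrC ler_pdivrMr; lra.
have mYX : measurable_fun setT (Y \o X) by exact: measurableT_comp.
have bYX : bmeas (Y \o X).
  split=> //; exists 1 => w; have /andP[y0 y1] := Y01 (X w).
  by rewrite ger0_norm.
have hY : h \o X = (fun w => (2 * K) * (Y \o X) w + - K).
  by apply/funext => w; rewrite /= mulVKf ?addrK// mulf_neq0// lt0r_neq0.
have mean_h (m : probability T R) : mean m (h \o X) = 2 * K * mean m (Y \o X) - K.
  have bc := @bmeas_cst _ T R (- K).
  by rewrite hY (meanD _ (bmeasZ _ bYX) bc) mean_cst meanZ.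
rewrite !mean_h opprB addrA addrNK -mulrBr normrM ger0_norm ?ler_pM2l//; [|lra|lra].
have lev (m : probability T R) n : mean m (levels n (Y \o X)) = n.+1%:R^-1 *
    \sum_(j < n.+1) fine (m (X @^-1` [set y | j.+1%:R <= n.+1%:R * Y y])).
  have bI (j : 'I_n.+1) : bmeas (\1_[set w | j.+1%:R <= n.+1%:R * (Y \o X) w] : T -> R).
    by apply: bmeas_indic; exact: measurable_superlevel.
  rewrite meanZ ?mean_sum//; last exact: bmeas_sum.
  congr (_ * _); apply: eq_bigr => j _; rewrite mean_indic//.
  exact: measurable_superlevel.
have levd n : `|mean mu (levels n (Y \o X)) - mean nu (levels n (Y \o X))| <= e.
  rewrite !lev -mulrBr normrM ger0_norm ?invr_ge0// mulrC ler_pdivrMr//.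
  rewrite -sumrB (le_trans (ler_norm_sum _ _ _))//.
  have -> : e * n.+1%:R = \sum_(j < n.+1) e by rewrite sumr_const card_ord mulr_natr.
  apply: ler_sum => j _.
  by apply: He; exact: measurable_superlevel.
have cv (m : probability T R) :
    mean m (levels n (Y \o X)) @[n --> \oo] --> mean m (Y \o X).
  apply: (@mean_cvg _ _ _ _ _ _ 2) => [n|n w|w].
  - exact: bmeas_levels.
  - have := @levels_dist _ _ _ n (Y \o X) w (Y01 (X w)); have := Y01 (X w) => /andP[y0 y1].
    have : n.+1%:R^-1 <= 1 :> R by rewrite invf_le1// ler1n.
    move: (levels n (Y \o X) w) (n.+1%:R^-1) => a b b1.
    rewrite /= !ler_norml => /andP[h1 h2]; apply/andP; split; lra.
  - exact: (@levels_cvg _ _ _ (Y \o X) w (Y01 (X w))).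
apply: cvgr_to_le (cvg_norm (cvgB (cv mu) (cv nu))) _.
exact: nearW.
Qed.

End TotalVariation.

(** * Riemann sums of right-continuous functions *)

Section RiemannSums.
Context {R : realType}.
Notation leb := (@lebesgue_measure R).

Lemma itv_bounded_integrable (a b : R) (g : R -> R) (K : R) :
  measurable_fun `]a, b]%classic g -> (forall u, `|g u| <= K) ->
  leb.-integrable `]a, b]%classic (EFin \o g).
Proof.
move=> mg gK; apply: measurable_bounded_integrable => //.
  by rewrite /= lebesgue_measure_itv/=; case: ifP => _; rewrite ?ltry// -EFinD ltry.
exists `|K|; split; first exact: num_real.
by move=> r Kr u _ /=; rewrite (le_trans (gK u))// (le_trans (ler_norm K))// ltW.
Qed.

(** Each cell carries the value at its right end: the sampling point then approaches u from the
    right, which is the side on which the paths are continuous. *)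
Definition step (a h : R) (phi : R -> R) (n : nat) (u : R) : R :=
  \sum_(i < n) phi (a + i.+1%:R * h) * \1_`]a + i%:R * h, a + i.+1%:R * h]%classic u.

Lemma measurable_step (a h : R) phi n D : measurable D -> measurable_fun D (step a h phi n).
Proof.
move=> mD; rewrite /step; apply: measurable_sum => i.
by apply: measurable_funM => //; apply: measurable_indic.
Qed.

Lemma step_eq (a h : R) phi n (u : R) : 0 < h -> a < u <= a + n%:R * h ->
  exists p : R, [/\ u <= p, p < u + h & step a h phi n u = phi p].
Proof.
move=> h0 /andP[au un].
have [j [ju uj]] : exists j : 'I_n, a + j%:R * h < u /\ u <= a + j.+1%:R * h.
  elim: n un => [|n IH] un; first by lra.
  have [/IH [j [j1 j2]]|nu] := leP u (a + n%:R * h).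
    by exists (widen_ord (leqnSn n) j).
  by exists ord_max.
exists (a + j.+1%:R * h); split => //.
  by move: ju; rewrite -natr1 mulrDl mul1r; lra.
rewrite /step (bigD1 j)//= big1 => [|i ij].
  by rewrite addr0 indicE mem_set ?mulr1//= in_itv/= ju.
rewrite indicE memNset ?mulr0//= in_itv/= => /andP[i1 i2].
have [ij'|] := ltnP i j.
  have : i.+1%:R * h <= j%:R * h by rewrite ler_pM2r// ler_nat.
  lra.
rewrite leq_eqVlt eq_sym val_eqE (negbTE ij)/= => ji.
have : j.+1%:R * h <= i%:R * h by rewrite ler_pM2r// ler_nat.
lra.
Qed.

Lemma Rintegral_step (a h : R) phi n (K : R) : 0 < h -> (forall u, `|phi u| <= K) ->
  \int[leb]_(u in `]a, (a + n%:R * h)%R]) step a h phi n u =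
  \sum_(i < n) h * phi (a + i.+1%:R * h).
Proof.
move=> h0 phiK; set D := [set` _].
have mD : measurable D by exact: measurable_itv.
have I1 (i : 'I_n) : leb.-integrable D (EFin \o
   (fun u => phi (a + i.+1%:R * h) * \1_`]a + i%:R * h, a + i.+1%:R * h]%classic u)).
  apply: (@itv_bounded_integrable _ _ _ K).
    by apply: measurable_funM => //; apply: measurable_indic.
  move=> u; rewrite indicE; case: (_ \in _); rewrite ?mulr1 ?mulr0 ?normr0//.
  exact: le_trans (phiK u).
transitivity (\sum_(i < n) \int[leb]_(u in D) (phi (a + i.+1%:R * h) *
    \1_`]a + i%:R * h, a + i.+1%:R * h]%classic u)).
  rewrite /step /Rintegral.
  under eq_integral do rewrite -sumEFin.
  rewrite integral_sum//=.
  rewrite -sum_fine// => i _; exact: integrable_fin_num (I1 i).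
apply: eq_bigr => i _.
have mI : measurable (`]a + i%:R * h, a + i.+1%:R * h]%classic : set R) by [].
have I2 : leb.-integrable D (EFin \o (\1_`]a + i%:R * h, a + i.+1%:R * h]%classic : R -> R)).
  apply: (@itv_bounded_integrable _ _ _ 1); first exact: measurable_indic.
  by move=> u; rewrite indicE; case: (_ \in _); rewrite ?normr1 ?normr0.
rewrite RintegralZl// mulrC; congr (_ * _).
rewrite /Rintegral integral_indic//.
rewrite (_ : _ `&` D = `]a + i%:R * h, a + i.+1%:R * h]%classic).
  rewrite /= lebesgue_measure_itv/= lte_fin ltrD2l ltr_pM2r// ltr_nat leqnn/=.
  by rewrite -natr1; lra.
apply/seteqP; split=> [u []//|u ui]; split=> //; move: ui.
rewrite /D/= !in_itv/= => /andP[u1 u2].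
have i0 : 0 <= i%:R * h by rewrite mulr_ge0// ltW.
have : i.+1%:R * h <= n%:R * h by rewrite ler_pM2r// ler_nat.
by move=> i1; apply/andP; split; lra.
Qed.

Definition right_cts (phi : R -> R) :=
  forall u, 0 <= u -> phi v @[v --> u^'+] --> phi u.

Lemma step_cvg (a s : R) phi (u : R) : 0 <= a -> 0 < s -> right_cts phi -> a < u <= a + s ->
  step a (s / n.+1%:R) phi n.+1 u @[n --> \oo] --> phi u.
Proof.
move=> a0 s0 cphi uas.
have u0 : 0 <= u by case/andP: uas => ? _; lra.
apply/cvgrPdist_le => e e0.
have /cvgrPdist_le/(_ _ e0) := cphi _ u0.
rewrite /at_right near_withinE => /nbhs_ballP[r/= r0 Br].
have : (n.+1%:R : R)^-1 @[n --> \oo] --> (0 : R) by exact: cvg_harmonic.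
move=> /cvgrPdist_lt /(_ _ (divr_gt0 r0 s0)); apply: filterS => n.
have h0 : 0 < s / n.+1%:R by rewrite divr_gt0.
rewrite sub0r normrN ger0_norm ?invr_ge0// ltr_pdivlMr// mulrC => hr0.
have hr : s / n.+1%:R < r := hr0.
have [|p [up pu ->]] := @step_eq a _ phi n.+1 u h0.
  by rewrite mulrC divfK ?pnatr_eq0//; case/andP: uas => -> ->.
move: up; rewrite le_eqVlt => /predU1P[<-|up].
  by rewrite subrr normr0 ltW.
apply: Br => //.
move: hr pu; set q := s / _ => hr pu.
by rewrite /ball/= ltr_norml; apply/andP; split; lra.
Qed.

(** Right-continuity alone gives measurability, through the pointwise limit of step functions. *)
Lemma right_cts_measurable (a s : R) phi : 0 <= a -> 0 < s -> right_cts phi ->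
  measurable_fun `]a, a + s]%classic phi.
Proof.
move=> a0 s0 cphi.
apply: (@measurable_fun_cvg _ _ _ _ (fun n => step a (s / n.+1%:R) phi n.+1)).
  by move=> n; exact: measurable_step.
by move=> u; rewrite /= in_itv/= => uas; exact: step_cvg.
Qed.

Lemma riemann_sum_cvg (a s : R) phi (K : R) : 0 <= a -> 0 < s -> right_cts phi ->
  (forall u, `|phi u| <= K) ->
  \sum_(i < n.+1) s / n.+1%:R * phi (a + i.+1%:R * (s / n.+1%:R)) @[n --> \oo]
  --> \int[leb]_(u in `]a, a + s]) phi u.
Proof.
move=> a0 s0 cphi phiK.
have h0 n : 0 < s / n.+1%:R by rewrite divr_gt0.
have hs n : n.+1%:R * (s / n.+1%:R) = s by rewrite mulrC divfK ?pnatr_eq0.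
under eq_fun do rewrite -(Rintegral_step _ _ (h0 _) phiK) hs.
have mD : measurable (`]a, a + s]%classic : set R) by [].
have iK c : leb.-integrable `]a, a + s]%classic (EFin \o cst c).
  exact: (@itv_bounded_integrable _ _ _ `|c|).
have mphi := right_cts_measurable a0 s0 cphi.
apply: fine_cvg; rewrite fineK; last first.
  exact: integrable_fin_num (itv_bounded_integrable mphi phiK).
apply: (@dominated_cvg _ _ _ leb _ _ (fun n u => (step a (s / n.+1%:R) phi n.+1 u)%:E)
  _ (cst K%:E)) => //.
- by move=> n; apply/measurable_EFinP; exact: measurable_step.
- move=> u; rewrite /= in_itv/= => uas.
  by apply: cvg_EFin; [exact: nearW|exact: step_cvg].
- exact: iK.
- move=> n u; rewrite /= in_itv/= => uas; rewrite lee_fin.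
  have [|p [_ _ ->//]] := @step_eq a _ phi n.+1 u (h0 n).
  by rewrite hs.
Qed.

Lemma Rintegral_right_cts_split (a s : R) phi (K : R) : 0 <= a -> 0 < s -> right_cts phi ->
  (forall u, `|phi u| <= K) ->
  \int[leb]_(u in `[0, a + s]) phi u - \int[leb]_(u in `[0, a]) phi u =
  \int[leb]_(u in `]a, a + s]) phi u.
Proof.
move=> a0 s0 cphi phiK.
have as0 : 0 < a + s by lra.
have i1 : leb.-integrable `]0, a + s]%classic (EFin \o phi).
  apply: itv_bounded_integrable phiK; rewrite -[a + s]add0r.
  exact: right_cts_measurable.
have i2 : leb.-integrable `]0, a]%classic (EFin \o phi).
  apply: integrableS i1 => // u; rewrite /= !in_itv/= => /andP[u1 u2].
  by apply/andP; split; lra.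
rewrite -!Rintegral_itv_obnd_cbnd//.
by rewrite Rintegral_itvB//; rewrite bnd_simp; lra.
Qed.

End RiemannSums.

(** * Total variation continuity and the Markov property *)

Section MetricTopology.
Context {R : realType} {E : topologicalType} (rho : E -> E -> R).
Hypothesis rhoP : metric_inducing rho.

Lemma rho_ball_nbhs (x : E) (r : R) : 0 < r -> nbhs x [set y | rho x y < r].
Proof.
have [rho0 [rho_eq [rhoC [rhoT rho_open]]]] := rhoP.
move=> r0; apply: open_nbhs_nbhs; split=> /=; last by rewrite (iffRL (rho_eq x x)).
apply/rho_open => y /= xy; exists (r - rho x y); split; first by rewrite subr_gt0.
move=> z /=; rewrite ltrBrDl; apply: le_lt_trans; exact: rhoT.
Qed.

Lemma rho_nbhs_ball (x : E) (S : set E) : nbhs x S ->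
  exists r : R, 0 < r /\ [set y | rho x y < r] `<=` S.
Proof.
have [rho0 [rho_eq [rhoC [rhoT rho_open]]]] := rhoP.
rewrite nbhsE => -[V [oV Vx] VS].
have [r [r0 rO]] := iffLR (rho_open V) oV x Vx.
by exists r; split => // y /rO /VS.
Qed.

(** (A2) speaks of sequences, whereas continuity is used through neighbourhoods. If [S] were no
    neighbourhood, a point outside [S] chosen in each ball of radius 1/(n+1) would form a forbidden
    sequence. *)
Lemma seq_nbhs (x : E) (S : set E) :
  (forall u : nat -> E, u n @[n --> \oo] --> x -> \forall n \near \oo, S (u n)) ->
  nbhs x S.
Proof.
move=> HS; apply: contrapT => nS.
have /choice[u uP] : forall n : nat, exists y, rho x y < n.+1%:R^-1 /\ ~ S y.
  move=> n.
  apply: contrapT => H; apply: nS.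
  apply: filterS (rho_ball_nbhs x (_ : 0 < n.+1%:R^-1)) => [y /= xy|]; last first.
    by rewrite invr_gt0.
  by apply: contrapT => Sy; apply: H; exists y.
have /HS [N _ /(_ N (leqnn N))] : u n @[n --> \oo] --> x; last by have [] := uP N.
move=> O /rho_nbhs_ball[r [r0 rO]].
have : (n.+1%:R : R)^-1 @[n --> \oo] --> (0 : R) by exact: cvg_harmonic.
move=> /cvgrPdist_lt /(_ _ r0); apply: filterS => n.
rewrite sub0r normrN ger0_norm ?invr_ge0// => nr.
by apply: rO => /=; apply: lt_trans nr; have [] := uP n.
Qed.

Lemma rho_closed1 (x : E) : closed [set x].
Proof.
have [rho0 [rho_eq [rhoC [rhoT rho_open]]]] := rhoP.
rewrite -(setCK [set x]); apply: open_closedC; apply/rho_open => y /= yx.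
exists (rho x y); split.
  by rewrite lt_neqAle rho0 andbT eq_sym; apply/eqP => /rho_eq/esym.
by move=> z /= yz zx; move: yz; rewrite zx rhoC ltxx.
Qed.

Lemma rho_compact_closed (A : set E) : compact A -> closed A.
Proof.
have [rho0 [rho_eq [rhoC [rhoT _]]]] := rhoP.
apply: compact_closed => x y xy; apply/rho_eq/eqP; rewrite eq_le rho0 andbT leNgt.
apply/negP => r0; have r2 : 0 < rho x y / 2 by rewrite divr_gt0.
have [z [/= xz yz]] := xy _ _ (rho_ball_nbhs x r2) (rho_ball_nbhs y r2).
by have := rhoT x z y; rewrite (rhoC z y); lra.
Qed.

End MetricTopology.

Section BorelFunctions.
Context {R : realType} {E : topologicalType} (e0 : E).

Lemma within_continuous_borel (D : set E) (h : E -> R) : closed D ->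
  {within D, continuous h} -> measurable_fun (D : set (borel_space e0)) h.
Proof.
move=> cD /continuousP ch; apply: (measurability _ (RGenOInfty.measurableE R)).
move=> _ [_ [a ->] <-].
have /open_subspaceP[V oV VD] := ch _ (rray_open a).
rewrite setIC -VD; apply: (@measurableI _ (borel_space e0)).
  exact: open_borelE.
exact: closed_borelE.
Qed.

Lemma continuous_borel (h : E -> R) : continuous h ->
  measurable_fun [set: borel_space e0] h.
Proof.
move=> ch; apply: (@within_continuous_borel setT); first exact: closedT.
exact: continuous_subspaceT.
Qed.

Lemma Cb_bmeas (h : E -> R) : Cb h -> @bmeas _ (borel_space e0) R h.
Proof.
move=> [ch [K hK]]; split; first exact: continuous_borel.
by exists K => x; exact: hK.
Qed.

End BorelFunctions.

Section MeanLinear.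
Context {d : measure_display} {T : measurableType d} {R : realType}.
Variable mu : probability T R.

Lemma mean_linear (a : R) (Z Y : T -> R) : bmeas Z -> bmeas Y ->
  mean mu (fun w => a * Z w + Y w) = a * mean mu Z + mean mu Y.
Proof. by move=> bZ bY; rewrite meanD ?meanZ//; exact: bmeasZ. Qed.

Lemma mean_linearl (a : R) (Z Y H : T -> R) : bmeas Z -> bmeas Y -> bmeas H ->
  mean mu (fun w => (a * Z w + Y w) * H w) =
  a * mean mu (fun w => Z w * H w) + mean mu (fun w => Y w * H w).
Proof.
move=> bZ bY bH; rewrite -mean_linear; [|exact: bmeasM..].
by congr (mean mu _); apply/funext => w; rewrite mulrDl mulrA.
Qed.

Lemma mean_linearr (a : R) (Z Y H : T -> R) : bmeas Z -> bmeas Y -> bmeas H ->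
  mean mu (fun w => H w * (a * Z w + Y w)) =
  a * mean mu (fun w => H w * Z w) + mean mu (fun w => H w * Y w).
Proof.
move=> bZ bY bH; rewrite -mean_linear; [|exact: bmeasM..].
by congr (mean mu _); apply/funext => w; rewrite mulrDr mulrCA.
Qed.

Lemma mean_cvgM (Zn : nat -> T -> R) (Z H : T -> R) (K : R) :
  (forall n, bmeas (Zn n)) -> (forall n w, `|Zn n w| <= K) -> bmeas H ->
  (forall w, Zn n w @[n --> \oo] --> Z w) ->
  mean mu (fun w => Zn n w * H w) @[n --> \oo] --> mean mu (fun w => Z w * H w).
Proof.
move=> bZ ZK bH cZ; have [_ [L HL]] := bH.
apply: (@mean_cvg _ _ _ _ _ _ (K * L)) => [n|n w|w].
- exact: bmeasM.
- by rewrite normrM ler_pM.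
- by apply: cvgMl; exact: cZ.
Qed.

Lemma mean_cvgMr (Zn : nat -> T -> R) (Z H : T -> R) (K : R) :
  (forall n, bmeas (Zn n)) -> (forall n w, `|Zn n w| <= K) -> bmeas H ->
  (forall w, Zn n w @[n --> \oo] --> Z w) ->
  mean mu (fun w => H w * Zn n w) @[n --> \oo] --> mean mu (fun w => H w * Z w).
Proof.
move=> bZ ZK bH cZ.
have e Y : mean mu (fun w => H w * Y w) = mean mu (fun w => Y w * H w).
  by congr (mean mu _); apply/funext => w; rewrite mulrC.
rewrite e; under eq_fun do rewrite e; exact: mean_cvgM bZ ZK bH cZ.
Qed.

End MeanLinear.

(** * Transition operators and the Markov property at fixed times *)

Section Markov.
Context {R : realType} {E : topologicalType} (e0 : E) {d : measure_display}
  {Omega : measurableType d}.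
Variables (P : E -> probability Omega R) (F : R -> set (set Omega))
  (X : R -> Omega -> E) (rho : E -> E -> R).
Hypotheses (rhoP : metric_inducing rho) (HF : is_filtration F)
  (HA : adapted F X) (HN : normal_process P X) (HS : strong_Markov P F X)
  (H2 : A2 P X).
Implicit Types t s u : R.
Notation EB := (borel_space e0).
Notation bE := (@bmeas _ EB R).
Notation bF t := (@bmeas _ (g_sigma_algebraType (F t)) R).

(** [F t] is a bare family of sets. Viewing it as a measurable structure lets every closure lemma on
    [bmeas] double as an adaptedness lemma, and generating the structure adds no sets because [F t]
    already is a sigma-algebra. *)
Lemma Ft_measurable t : 0 <= t ->
  @measurable _ (g_sigma_algebraType (F t)) = F t.
Proof. by move=> t0; apply: measurable_g_measurableTypeE; have [] := HF.1 t t0. Qed.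

Lemma bF_bmeas t (Z : Omega -> R) : 0 <= t -> bF t Z -> bmeas Z.
Proof.
move=> t0 [mZ ZK]; split=> // _ V mV; apply: (HF.1 t t0).2.
rewrite -Ft_measurable//; exact: mZ.
Qed.

Lemma bF_le s t (Z : Omega -> R) : 0 <= s -> s <= t -> bF s Z -> bF t Z.
Proof.
move=> s0 st [mZ ZK]; split=> // _ V mV.
rewrite Ft_measurable ?(le_trans s0)//; apply: (HF.2 s t s0 st).
rewrite -Ft_measurable//; exact: mZ.
Qed.

Lemma bF_X t (h : E -> R) : 0 <= t -> bE h -> bF t (fun w => h (X t w)).
Proof.
move=> t0 [mh [K hK]]; split; last by exists K => w; exact: hK.
move=> _ V mV; rewrite setTI Ft_measurable//.
have mhV : borelE (h @^-1` V) by have := mh measurableT V mV; rewrite setTI.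
exact: (HA t0 mhV).
Qed.

Lemma bmeas_X t (h : E -> R) : 0 <= t -> bE h -> bmeas (fun w => h (X t w)).
Proof. by move=> t0 bh; apply: (bF_bmeas t0); exact: bF_X. Qed.

Lemma measurable_X t : 0 <= t -> measurable_fun setT (X t : Omega -> EB).
Proof.
move=> t0 _ V mV; rewrite setTI; apply: (HF.1 t t0).2; exact: HA.
Qed.

Lemma mean_X0 (h : E -> R) x : bE h -> mean (P x) (fun w => h (X 0 w)) = h x.
Proof.
move=> bh; rewrite -[RHS](mean_cst (P x)).
apply: (@eq_mean_prob1 _ _ _ _ _ _ [set w | X 0 w = x]).
- rewrite -[X in measurable X]setTI.
  apply: (measurable_X (lexx 0) measurableT (Y := [set x])).
  by apply: closed_borelE; exact: (rho_closed1 rhoP).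
- exact: HN.
- exact: (bmeas_X (lexx 0) bh).1.
- exact: measurable_cst.
- by move=> w /= ->.
Qed.

Definition Pop (t : R) (h : E -> R) (x : E) : R := mean (P x) (fun w => h (X t w)).

Lemma tv_nbhs t x (e : R) : 0 < t -> 0 < e ->
  nbhs x [set y | forall A, borelE A ->
    `|fine (P y (X t @^-1` A)) - fine (P x (X t @^-1` A))| <= e].
Proof.
move=> t0 e_gt0; apply: (seq_nbhs rhoP) => u ux; exact: H2 ux e e_gt0.
Qed.

Lemma Pop_nbhs t x (K e : R) : 0 < t -> 0 < K -> 0 < e ->
  nbhs x [set y | forall h, bE h -> (forall z, `|h z| <= K) ->
    `|Pop t h y - Pop t h x| <= e].
Proof.
move=> t0 K0 e_gt0.
have eK : 0 < e / (2 * K) by rewrite divr_gt0// mulr_gt0.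
apply: filterS (tv_nbhs x t0 eK) => y yx h bh hK.
have := @mean_dist _ _ _ _ EB (P y) (P x) (X t) h K _ (measurable_X (ltW t0)) K0 bh.1 hK yx.
by rewrite mulrC divfK// mulf_neq0// lt0r_neq0.
Qed.

Lemma Pop_norm t x (h : E -> R) K : 0 <= t -> bE h -> (forall z, `|h z| <= K) ->
  `|Pop t h x| <= K.
Proof. by move=> t0 bh hK; apply: mean_norm_le => //; exact: bmeas_X. Qed.

(** Strong Feller property: continuity in total variation makes [Pop t h] continuous for merely
    measurable [h]. This is also what makes [Pop t h] measurable, so that the operators can be
    iterated. *)
Lemma Pop_Cb t (h : E -> R) : 0 < t -> bE h -> Cb (Pop t h).
Proof.
move=> t0 bh; have [mh [K hK]] := bh; split; last first.
  by exists K => x _; apply: Pop_norm => //; exact: ltW.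
have K1 : 0 < `|K| + 1 by rewrite ltr_wpDl.
move=> x; apply/cvgrPdist_le => e e_gt0.
apply: filterS (Pop_nbhs x t0 K1 e_gt0) => y /(_ h bh).
rewrite distrC; apply => z.
by rewrite (le_trans (hK z))// (le_trans (ler_norm K))// lerDl.
Qed.

(** The strong Markov property at the constant time t, for which the event {T <= u} is everything or
    nothing. *)
Lemma Markov_indic t s (A : set Omega) (B : set E) x : 0 <= t -> 0 <= s ->
  F t A -> borelE B ->
  P x (A `&` [set w | B (X (t + s) w)]) =
  (\int[P x]_(w in A) P (X t w) (X s @^-1` B))%E.
Proof.
move=> t0 s0 FA bB.
have sT : stopping_time F (fun=> t%:E).
  split=> [w|u u0]; first by rewrite lee_fin.
  rewrite -Ft_measurable//; have [tu|tu] := leP t u.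
    rewrite (_ : [set _ | _] = setT)//.
    by apply/seteqP; split=> w //=; rewrite lee_fin.
  rewrite (_ : [set _ | _] = set0)//.
  by apply/seteqP; split=> w //=; rewrite lee_fin leNgt tu.
have AT : A `&` [set w | (t%:E < +oo)%E] = A.
  by apply/seteqP; split=> [w []//|w Aw]; split=> //=; rewrite ltry.
have iA : in_F_T F (fun=> t%:E) A.
  split; first exact: (HF.1 t t0).2.
  move=> u u0; rewrite -Ft_measurable//; have [tu|tu] := leP t u.
    rewrite (_ : _ `&` _ = A) ?Ft_measurable//; first exact: (HF.2 t u t0 tu).
    by apply/seteqP; split=> [w []//|w Aw]; split=> //=; rewrite lee_fin.
  rewrite (_ : _ `&` _ = set0)//; apply/seteqP; split=> w //= [_].
  by rewrite lee_fin leNgt tu.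
have := HS sT iA s0 bB x; rewrite AT /= => <-; congr (P x _).
by apply/seteqP; split=> [w [Aw Bw]|w [Aw [_ Bw]]]; split=> //; split; rewrite ?ltry.
Qed.

Lemma Pop_linear t a (g h : E -> R) x : 0 <= t -> bE g -> bE h ->
  Pop t (fun y => a * g y + h y) x = a * Pop t g x + Pop t h x.
Proof. by move=> t0 bg bh; apply: mean_linear; exact: bmeas_X. Qed.

(** Two monotone-class arguments, in [h] and, once [h] is an indicator, in [Z]. The condition 0 < s
    provides the measurability of [Pop s h]. *)
Lemma Markov1 t s (Z : Omega -> R) (h : E -> R) x : 0 <= t -> 0 < s ->
  bF t Z -> bE h ->
  mean (P x) (fun w => Z w * h (X (t + s) w)) =
  mean (P x) (fun w => Z w * Pop s h (X t w)).
Proof.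
move=> t0 s0 bZ bh.
have ts0 : 0 <= t + s by rewrite addr_ge0// ltW.
have s0' := ltW s0.
have bP g : bE g -> bE (Pop s g) by move=> bg; apply: Cb_bmeas; exact: Pop_Cb.
have bXs g : bE g -> bmeas (fun w => g (X (t + s) w)) by exact: bmeas_X.
have bPX g : bE g -> bmeas (fun w => Pop s g (X t w)).
  by move=> bg; apply: bmeas_X => //; exact: bP.
move: h bh; apply: (@bmeas_ind R _ EB (fun h =>
  mean (P x) (fun w => Z w * h (X (t + s) w)) =
  mean (P x) (fun w => Z w * Pop s h (X t w)))) => /=.
- move=> B mB; have bB : bE (\1_B) by exact: bmeas_indic.
  have indA (A : set Omega) : F t A ->
      mean (P x) (fun w => \1_A w * \1_B (X (t + s) w)) =
      mean (P x) (fun w => \1_A w * Pop s \1_B (X t w)).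
    move=> FA.
    have mA : measurable A by exact: (HF.1 t t0).2.
    have mXB u : 0 <= u -> measurable [set w | B (X u w)].
      by move=> u0; have := measurable_X u0 measurableT (Y := B) mB; rewrite setTI.
    transitivity (mean (P x) \1_(A `&` [set w | B (X (t + s) w)])).
      congr (mean _ _); apply/funext => w.
      by rewrite !indicE in_setI -natrM mulnb.
    rewrite mean_indic; last by apply: measurableI => //; exact: mXB.
    rewrite Markov_indic// integral_mkcond /mean /Rintegral; congr fine.
    apply: eq_integral => w _; rewrite patchE indicE.
    case: ifP => wA; last by rewrite mul0r.
    rewrite mul1r /Pop.
    rewrite (_ : (fun w0 => \1_B (X s w0)) = \1_(X s @^-1` B))//.
    by rewrite mean_indic ?fineK ?fin_num_measure//; exact: mXB.
  move: Z bZ.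
  apply: (@bmeas_ind R _ (g_sigma_algebraType (F t)) (fun Z =>
    mean (P x) (fun w => Z w * \1_B (X (t + s) w)) =
    mean (P x) (fun w => Z w * Pop s \1_B (X t w)))) => /=.
  + by move=> A; rewrite Ft_measurable//; exact: indA.
  + move=> a Z Y /(bF_bmeas t0) bZ /(bF_bmeas t0) bY IZ IY.
    by rewrite !mean_linearl ?IZ ?IY//; [exact: bPX|exact: bXs].
  + move=> Zn Z K bZ IZ ZK cZ.
    have bZ' n := bF_bmeas t0 (bZ n).
    have := @mean_cvgM _ Omega R (P x) Zn Z _ K bZ' ZK (bXs _ bB) cZ.
    have := @mean_cvgM _ Omega R (P x) Zn Z _ K bZ' ZK (bPX _ bB) cZ.
    under eq_fun do rewrite -IZ.
    by move=> c1 c2; rewrite -(cvg_lim _ c1)// -(cvg_lim _ c2).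
- move=> a g h bg bh Ig Ih.
  have bZ' := bF_bmeas t0 bZ.
  rewrite mean_linearr ?Ig ?Ih//; [|exact: bXs..].
  rewrite -mean_linearr//; [|exact: bPX..].
  by congr (mean _ _); apply/funext => w; rewrite Pop_linear.
- move=> hn h K bh Ih hK ch.
  have bZ' := bF_bmeas t0 bZ.
  have c1 : mean (P x) (fun w => Z w * hn n (X (t + s) w)) @[n --> \oo] -->
            mean (P x) (fun w => Z w * h (X (t + s) w)).
    by apply: (@mean_cvgMr _ _ _ _ _ _ _ K) => // n; exact: bXs.
  have c2 : mean (P x) (fun w => Z w * Pop s (hn n) (X t w)) @[n --> \oo] -->
            mean (P x) (fun w => Z w * Pop s h (X t w)).
    apply: (@mean_cvgMr _ _ _ _ _ _ _ K) => // [n|n w|w].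
    + exact: bPX.
    + exact: Pop_norm.
    + by apply: (@mean_cvg _ _ _ _ _ _ K) => // n; exact: bmeas_X.
  move: c1; under eq_fun do rewrite Ih.
  by move=> c1; rewrite -(cvg_lim _ c1)// -(cvg_lim _ c2).
Qed.

End Markov.

(** * The Feynman-Kac semigroup *)

Section FeynmanKac.
Context {R : realType} {E : topologicalType} (e0 : E) {d : measure_display}
  {Omega : measurableType d}.
Variables (P : E -> probability Omega R) (F : R -> set (set Omega))
  (X : R -> Omega -> E) (rho : E -> E -> R) (f : E -> R) (Kf : R).
Hypotheses (rhoP : metric_inducing rho) (HF : is_filtration F)
  (HA : adapted F X) (HC : cadlag_paths X) (HN : normal_process P X)
  (HS : strong_Markov P F X) (H2 : A2 P X)
  (fcont : continuous f) (f_le0 : forall x, f x <= 0)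
  (f_norm : forall x, `|f x| <= Kf).
Implicit Types t s u : R.
Notation EB := (borel_space e0).
Notation bE := (@bmeas _ EB R).
Notation bF t := (@bmeas _ (g_sigma_algebraType (F t)) R).

Lemma bmeas_f : bE f.
Proof. by apply: Cb_bmeas; split=> //; exists Kf => x _. Qed.

Lemma path_right_cts w : right_cts (fun s => f (X s w)).
Proof.
by move=> u u0; apply: (cvg_comp _ f (HC w u0).1); exact: fcont.
Qed.

Definition riemann_path t s n w : R :=
  \sum_(i < n.+1) s / n.+1%:R * f (X (t + i.+1%:R * (s / n.+1%:R)) w).

Lemma riemann_path_cvg t s w : 0 <= t -> 0 < s ->
  riemann_path t s n w @[n --> \oo] --> pathint X f (t + s) w - pathint X f t w.
Proof.
move=> t0 s0; have phiK u : `|f (X u w)| <= Kf by [].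
rewrite /pathint (Rintegral_right_cts_split t0 s0 (@path_right_cts w) phiK).
exact: riemann_sum_cvg t0 s0 (@path_right_cts w) phiK.
Qed.

Lemma pathint0 w : pathint X f 0 w = 0.
Proof. by rewrite /pathint set_itv1 Rintegral_set1. Qed.

Lemma riemann_path_bounds t s n w : 0 < s ->
  - (Kf * s) <= riemann_path t s n w <= 0.
Proof.
move=> s0; have sn0 : 0 <= s / n.+1%:R by rewrite divr_ge0// ltW.
apply/andP; split; last by apply: sumr_le0 => i _; rewrite mulr_ge0_le0.
have -> : - (Kf * s) = \sum_(i < n.+1) s / n.+1%:R * (- Kf).
  rewrite sumr_const card_ord -(mulr_natr (s / _ * _)) mulrAC divfK ?pnatr_eq0//.
  by rewrite mulrN mulrC.
apply: ler_sum => i _; rewrite ler_wpM2l//.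
by have := f_norm (X (t + i.+1%:R * (s / n.+1%:R)) w); rewrite ler_norml => /andP[].
Qed.

Lemma pathint_incr_bounds t s w : 0 <= t -> 0 <= s ->
  - (Kf * s) <= pathint X f (t + s) w - pathint X f t w <= 0.
Proof.
move=> t0; rewrite le_eqVlt => /predU1P[<-|s0].
  by rewrite addr0 subrr mulr0 oppr0 lexx.
have c := @riemann_path_cvg t s w t0 s0; apply/andP; split.
  apply: cvgr_to_ge c _; apply: nearW => n.
  by have /andP[] := riemann_path_bounds t n w s0.
apply: cvgr_to_le c _; apply: nearW => n.
by have /andP[] := riemann_path_bounds t n w s0.
Qed.

Lemma pathint_bounds t w : 0 <= t -> - (Kf * t) <= pathint X f t w <= 0.
Proof.
by move=> t0; have := pathint_incr_bounds w (lexx 0) t0; rewrite add0r pathint0 subr0.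
Qed.

Lemma bF_riemann_path t s n : 0 <= t -> 0 <= s -> bF (t + s) (riemann_path t s n).
Proof.
move=> t0 s0; apply: bmeas_sum => i; apply: bmeasZ.
have i0 : 0 <= i.+1%:R * (s / n.+1%:R) by rewrite mulr_ge0// divr_ge0.
apply: (@bF_le _ _ _ _ HF (t + i.+1%:R * (s / n.+1%:R))).
- exact: addr_ge0.
- by rewrite lerD2l mulrCA ler_piMr// ler_pdivrMr// mul1r ler_nat.
- by apply: (@bF_X _ _ e0 _ _ _ _ HF HA _ _ _ bmeas_f); exact: addr_ge0.
Qed.

(** Adaptedness of the integral comes from Riemann sums, each of which involves finitely many times
    up to t; this takes the place of an argument by joint measurability in time and path. *)
Lemma bF_pathint t : 0 <= t -> bF t (pathint X f t).
Proof.
rewrite le_eqVlt => /predU1P[<-|t0].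
  have -> : pathint X f 0 = fun=> 0 by apply/funext => w; exact: pathint0.
  exact: bmeas_cst.
apply: (@bmeas_cvg _ (g_sigma_algebraType (F t)) _ (riemann_path 0 t) _ (Kf * t)).
- by move=> n; have := bF_riemann_path n (lexx 0) (ltW t0); rewrite add0r.
- move=> n w; have /andP[h1 h2] := riemann_path_bounds 0 n w t0.
  by rewrite ler0_norm// lerNl.
- move=> w; have := @riemann_path_cvg 0 t w (lexx 0) t0.
  by rewrite add0r pathint0 subr0.
Qed.

Lemma bmeas_pathint t : 0 <= t -> bmeas (pathint X f t).
Proof. by move=> t0; apply: (bF_bmeas HF t0); exact: bF_pathint. Qed.

(** One factor P_u e^{u f} of a Trotter product: its powers with step s/n carry a Riemann sum in the
    exponent and converge to [Qop s]. *)
Definition Pe (u : R) (h : E -> R) : E -> R :=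
  Pop P X u (fun y => expR (u * f y) * h y).

Definition Qop (t : R) (h : E -> R) (x : E) : R :=
  mean (P x) (fun w => expR (pathint X f t w) * h (X t w)).

Lemma bmeas_expf u h : bE h -> bE (fun y => expR (u * f y) * h y).
Proof.
by move=> bh; apply: bmeasM => //; apply: bmeas_expR; apply: bmeasZ; exact: bmeas_f.
Qed.

Lemma bmeas_Pe u h : 0 < u -> bE h -> bE (Pe u h).
Proof.
move=> u0 bh; apply: Cb_bmeas; apply: (@Pop_Cb _ _ e0 _ _ P F X rho) => //.
exact: bmeas_expf.
Qed.

Lemma bmeas_iter_Pe k u h : 0 < u -> bE h -> bE (iter k (Pe u) h).
Proof. by move=> u0 bh; elim: k => //= k; exact: bmeas_Pe. Qed.

(** Induction on the last sampling time: all earlier factors are measurable at time t + k u, so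
    [Markov1] turns the last step into an application of [Pe u] to [h]. *)
Lemma mean_iter_Pe t u k (Z : Omega -> R) (h : E -> R) x : 0 <= t -> 0 < u ->
  bF t Z -> bE h ->
  mean (P x) (fun w => Z w * (expR (\sum_(i < k) u * f (X (t + i.+1%:R * u) w)) *
                              h (X (t + k%:R * u) w))) =
  mean (P x) (fun w => Z w * iter k (Pe u) h (X t w)).
Proof.
move=> t0 u0 bZ; elim: k h => [|k IH] h bh.
  congr (mean _ _); apply/funext => w.
  by rewrite big_ord0 expR0 mul1r mul0r addr0.
rewrite iterSr -IH; last exact: bmeas_Pe.
have ku0 : 0 <= k%:R * u by rewrite mulr_ge0// ltW.
have tk0 : 0 <= t + k%:R * u by exact: addr_ge0.
pose Y w := Z w * expR (\sum_(i < k) u * f (X (t + i.+1%:R * u) w)).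
have bY : bF (t + k%:R * u) Y.
  apply: bmeasM.
    by apply: (@bF_le _ _ _ _ HF t) => //; rewrite lerDl.
  apply: bmeas_expR; apply: bmeas_sum => i; apply: bmeasZ.
  have i0 : 0 <= i.+1%:R * u by rewrite mulr_ge0// ltW.
  apply: (@bF_le _ _ _ _ HF (t + i.+1%:R * u)).
  - exact: addr_ge0.
  - by rewrite lerD2l ler_pM2r// ler_nat.
  - by apply: (@bF_X _ _ e0 _ _ _ _ HF HA _ _ _ bmeas_f); exact: addr_ge0.
transitivity (mean (P x) (fun w => Y w *
    (fun y => expR (u * f y) * h y) (X (t + k%:R * u + u) w))).
  congr (mean _ _); apply/funext => w; rewrite /Y big_ord_recr/= expRD.
  have -> : t + k%:R * u + u = t + k.+1%:R * u by rewrite -natr1 mulrDl mul1r addrA.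
  by rewrite !mulrA.
apply: etrans (@Markov1 _ _ e0 _ _ P F X rho rhoP HF HA HS H2 (t + k%:R * u) u Y _ x
  tk0 u0 bY (bmeas_expf u bh)) _.
by congr (mean _ _); apply/funext => w; rewrite /Y mulrA.
Qed.

Lemma natr_divK s n : n.+1%:R * (s / n.+1%:R) = s.
Proof. by rewrite mulrC divfK ?pnatr_eq0. Qed.

Lemma iter_Pe_eq s n (h : E -> R) x : 0 < s -> bE h ->
  iter n.+1 (Pe (s / n.+1%:R)) h x =
  mean (P x) (fun w => expR (riemann_path 0 s n w) * h (X s w)).
Proof.
move=> s0 bh; have u0 : 0 < s / n.+1%:R by rewrite divr_gt0.
have := @mean_iter_Pe 0 _ n.+1 (fun=> 1) h x (lexx 0) u0 (bmeas_cst _) bh.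
rewrite natr_divK add0r.
under eq_fun do rewrite mul1r.
move=> ->; under eq_fun do rewrite mul1r.
rewrite (@mean_X0 _ _ e0 _ _ P F X rho)//.
exact: bmeas_iter_Pe.
Qed.

Lemma bmeas_exp_riemann t s n (h : E -> R) : 0 <= t -> 0 < s -> bE h ->
  bmeas (fun w => expR (riemann_path t s n w) * h (X (t + s) w)).
Proof.
move=> t0 s0 bh; have ts0 : 0 <= t + s by rewrite addr_ge0// ltW.
apply: bmeasM; last exact: (@bmeas_X _ _ e0 _ _ _ _ HF HA).
apply: bmeas_expR; apply: (bF_bmeas HF ts0); apply: bF_riemann_path => //; exact: ltW.
Qed.

Lemma exp_riemann_norm t s n (h : E -> R) K w : 0 < s -> (forall y, `|h y| <= K) ->
  `|expR (riemann_path t s n w) * h (X (t + s) w)| <= K.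
Proof.
move=> s0 hK; rewrite normrM ger0_norm ?expR_ge0// -[leRHS]mul1r ler_pM ?expR_ge0//.
by rewrite expR_le1; have /andP[] := riemann_path_bounds t n w s0.
Qed.

Lemma exp_riemann_cvg t s (h : E -> R) w : 0 <= t -> 0 < s ->
  expR (riemann_path t s n w) * h (X (t + s) w) @[n --> \oo] -->
  expR (pathint X f (t + s) w - pathint X f t w) * h (X (t + s) w).
Proof.
move=> t0 s0; apply: cvgMl; apply: continuous_cvg; first exact: continuous_expR.
exact: riemann_path_cvg.
Qed.

Lemma iter_Pe_cvg s (h : E -> R) x : 0 < s -> bE h ->
  iter n.+1 (Pe (s / n.+1%:R)) h x @[n --> \oo] --> Qop s h x.
Proof.
move=> s0 bh; have [_ [K hK]] := bh.
under eq_fun do rewrite iter_Pe_eq//.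
apply: (@mean_cvg _ _ _ _ _ _ K) => [n|n w|w].
- by have := bmeas_exp_riemann n (lexx 0) s0 bh; rewrite add0r.
- by have := exp_riemann_norm 0 n w s0 hK; rewrite add0r.
- by have := @exp_riemann_cvg 0 s h w (lexx 0) s0; rewrite add0r pathint0 subr0.
Qed.

Lemma iter_Pe_norm s n (h : E -> R) K x : 0 < s -> bE h -> (forall y, `|h y| <= K) ->
  `|iter n.+1 (Pe (s / n.+1%:R)) h x| <= K.
Proof.
move=> s0 bh hK; rewrite iter_Pe_eq//; apply: mean_norm_le => [|w].
  by have := bmeas_exp_riemann n (lexx 0) s0 bh; rewrite add0r.
by have := exp_riemann_norm 0 n w s0 hK; rewrite add0r.
Qed.

Lemma bmeas_Qop s (h : E -> R) : 0 < s -> bE h -> bE (Qop s h).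
Proof.
move=> s0 bh; have [_ [K hK]] := bh.
apply: (@bmeas_cvg _ EB _ (fun n => iter n.+1 (Pe (s / n.+1%:R)) h) _ K).
- by move=> n; apply: bmeas_iter_Pe => //; rewrite divr_gt0.
- by move=> n x; exact: iter_Pe_norm.
- by move=> x; exact: iter_Pe_cvg.
Qed.

(** The weight depends on the whole path over [t, t + s], whereas [Markov1] concerns a single later
    time. With Riemann sums in the exponent finitely many times remain, and both sides pass to the
    limit by dominated convergence. *)
Lemma mean_Markov_incr t s (Z : Omega -> R) (h : E -> R) x : 0 <= t -> 0 < s ->
  bF t Z -> bE h ->
  mean (P x) (fun w => Z w * (expR (pathint X f (t + s) w - pathint X f t w) *
                              h (X (t + s) w))) =
  mean (P x) (fun w => Z w * Qop s h (X t w)).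
Proof.
move=> t0 s0 bZ bh; have [_ [K hK]] := bh.
have bZ' := bF_bmeas HF t0 bZ.
have c1 : mean (P x) (fun w => Z w * (expR (riemann_path t s n w) * h (X (t + s) w)))
    @[n --> \oo] --> mean (P x) (fun w => Z w *
      (expR (pathint X f (t + s) w - pathint X f t w) * h (X (t + s) w))).
  apply: (@mean_cvgMr _ _ _ _ _ _ _ K) => // [n|n w|w].
  - exact: bmeas_exp_riemann.
  - exact: exp_riemann_norm.
  - exact: exp_riemann_cvg.
have c2 : mean (P x) (fun w => Z w * iter n.+1 (Pe (s / n.+1%:R)) h (X t w))
    @[n --> \oo] --> mean (P x) (fun w => Z w * Qop s h (X t w)).
  apply: (@mean_cvgMr _ _ _ _ _ _ _ K) => // [n|n w|w].
  - apply: (@bmeas_X _ _ e0 _ _ _ _ HF HA _ _ t0); apply: bmeas_iter_Pe => //; rewrite divr_gt0//.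
  - exact: iter_Pe_norm.
  - exact: iter_Pe_cvg.
suff e n : mean (P x) (fun w => Z w * (expR (riemann_path t s n w) * h (X (t + s) w))) =
    mean (P x) (fun w => Z w * iter n.+1 (Pe (s / n.+1%:R)) h (X t w)).
  move: c1; under eq_fun do rewrite e.
  by move=> c1; rewrite -(cvg_lim _ c1)// -(cvg_lim _ c2).
have sn0 : 0 < s / n.+1%:R by rewrite divr_gt0.
by rewrite -(mean_iter_Pe _ _ t0 sn0 bZ bh) natr_divK.
Qed.

Lemma mean_Markov t s (Z : Omega -> R) (h : E -> R) x : 0 <= t -> 0 < s ->
  bF t Z -> bE h ->
  mean (P x) (fun w => Z w * expR (pathint X f (t + s) w) * h (X (t + s) w)) =
  mean (P x) (fun w => Z w * expR (pathint X f t w) * Qop s h (X t w)).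
Proof.
move=> t0 s0 bZ bh; rewrite -mean_Markov_incr//; last first.
  by apply: bmeasM => //; apply: bmeas_expR; exact: bF_pathint.
congr (mean _ _); apply/funext => w.
rewrite !mulrA; congr (_ * _).
by rewrite -mulrA -expRD [_ + (_ - _)]addrC subrK.
Qed.

Lemma bmeas_Q_integrand t (h : E -> R) : 0 <= t -> bE h ->
  bmeas (fun w => expR (pathint X f t w) * h (X t w)).
Proof.
move=> t0 bh; apply: bmeasM; last exact: (@bmeas_X _ _ e0 _ _ _ _ HF HA).
by apply: bmeas_expR; exact: bmeas_pathint.
Qed.

Lemma Qop_linear t a (g h : E -> R) x : 0 <= t -> bE g -> bE h ->
  Qop t (fun y => a * g y + h y) x = a * Qop t g x + Qop t h x.
Proof.
move=> t0 bg bh; rewrite /Qop -mean_linear; [|exact: bmeas_Q_integrand..].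
by congr (mean _ _); apply/funext => w; rewrite mulrDr mulrCA.
Qed.

Lemma le_Qop t (g h : E -> R) x : 0 <= t -> bE g -> bE h -> (forall y, g y <= h y) ->
  Qop t g x <= Qop t h x.
Proof.
move=> t0 bg bh gh; apply: le_mean => [||w]; [exact: bmeas_Q_integrand..|].
by rewrite ler_pM2l// expR_gt0.
Qed.

Lemma Qop_norm t (h : E -> R) K x : 0 <= t -> bE h -> (forall y, `|h y| <= K) ->
  `|Qop t h x| <= K.
Proof.
move=> t0 bh hK; apply: mean_norm_le => [|w]; first exact: bmeas_Q_integrand.
rewrite normrM ger0_norm ?expR_ge0// -[leRHS]mul1r ler_pM ?expR_ge0//.
by rewrite expR_le1; have /andP[] := pathint_bounds w t0.
Qed.

Lemma Qop_cvg t (hn : nat -> E -> R) (h : E -> R) K x : 0 <= t ->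
  (forall n, bE (hn n)) -> (forall n y, `|hn n y| <= K) ->
  (forall y, hn n y @[n --> \oo] --> h y) ->
  Qop t (hn n) x @[n --> \oo] --> Qop t h x.
Proof.
move=> t0 bh hK ch; apply: (@mean_cvgMr _ _ _ _ _ _ _ K) => // [n|].
  exact: (@bmeas_X _ _ e0 _ _ _ _ HF HA).
by apply: bmeas_expR; exact: bmeas_pathint.
Qed.

Lemma Qop_semigroup t s (h : E -> R) x : 0 <= t -> 0 < s -> bE h ->
  Qop (t + s) h x = Qop t (Qop s h) x.
Proof.
move=> t0 s0 bh; have := @mean_Markov t s (fun=> 1) h x t0 s0 (bmeas_cst _) bh.
by under eq_fun do rewrite mul1r; under [X in _ = mean _ X -> _]eq_fun do rewrite mul1r.
Qed.

(* Strong Feller property: up to O(u) the weight over [0, u] can be dropped,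
   and then the law of X_u is continuous in total variation. *)
Lemma Qop_Cb t (h : E -> R) : 0 < t -> bE h -> Cb (Qop t h).
Proof.
move=> t0 bh; have [_ [K0 hK0]] := bh; split; last first.
  by exists K0 => x _; apply: Qop_norm => //; exact: ltW.
pose K := `|K0| + 1.
have K_gt0 : 0 < K by rewrite ltr_wpDl.
have hK y : `|h y| <= K.
  by rewrite (le_trans (hK0 y))// (le_trans (ler_norm K0))// lerDl.
have Kf0 : 0 <= Kf by exact: le_trans (f_norm e0).
have close u y : 0 < u -> u < t ->
    `|Qop t h y - Pop P X u (Qop (t - u) h) y| <= Kf * u * K.
  move=> u0 ut; have tu0 : 0 < t - u by rewrite subr_gt0.
  have e1 : Pop P X u (Qop (t - u) h) y = mean (P y) (fun w =>
      expR (pathint X f t w - pathint X f u w) * h (X t w)).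
    have := @mean_Markov_incr u (t - u) (fun=> 1) h y (ltW u0) tu0 (bmeas_cst _) bh.
    rewrite addrC subrK.
    under eq_fun do rewrite mul1r.
    by move=> ->; congr (mean _ _); apply/funext => w; rewrite mul1r.
  have b1 : bmeas (fun w => expR (pathint X f t w - pathint X f u w) * h (X t w)).
    apply: bmeasM; last by apply: (@bmeas_X _ _ e0 _ _ _ _ HF HA) => //; exact: ltW.
    by apply: bmeas_expR; apply: bmeasB; apply: bmeas_pathint; exact: ltW.
  have b2 := bmeas_Q_integrand (ltW t0) bh.
  rewrite e1 -meanB//; apply: mean_norm_le => [|w]; first exact: bmeasB.
  rewrite -mulrBl normrM ler_pM//.
  have := pathint_incr_bounds w (ltW u0) (ltW tu0).
  have := pathint_bounds w (ltW u0).
  rewrite [u + _]addrC subrK; set p := pathint _ _ t w; set q := pathint _ _ u w.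
  move=> /andP[q1 q2] /andP[p1 p2].
  have -> : expR p = expR q * expR (p - q) by rewrite -expRD addrC subrK.
  have eq1 : 1 + q <= expR q by exact: expR_ge1Dx.
  have eq2 : expR q <= 1 by rewrite expR_le1.
  have ep2 : expR (p - q) <= 1 by rewrite expR_le1.
  have ep1 := expR_ge0 (p - q).
  rewrite -{2}[expR (p - q)]mul1r -mulrBl normrM [X in _ * X]ger0_norm//.
  rewrite ler0_norm ?subr_le0// opprB.
  apply: (@le_trans _ _ (1 - expR q)); last by lra.
  by rewrite ler_piMr// subr_ge0.
move=> x; apply/cvgrPdist_le => e e_gt0.
(* With u <= e / D, dropping the weight over [0, u] costs at most e/3 at x and at y; the last third
   is continuity of [Pop]. The [+ 1] keeps D positive when [Kf] is 0. *)
pose D := 3 * (Kf + 1) * K.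
have D0 : 0 < D by rewrite !mulr_gt0//; lra.
pose u := Num.min (t / 2) (e / D).
have u0 : 0 < u by rewrite lt_min !divr_gt0.
have ut : u < t by rewrite gt_min; apply/orP; left; lra.
have uD : Kf * u * K <= e / 3.
  have : u <= e / D by rewrite ge_min lexx orbT.
  rewrite ler_pdivlMr// /D => uD.
  have : Kf * u * K <= (Kf + 1) * u * K by rewrite ler_pM2r// ler_pM2r//; lra.
  by lra.
have [cP _] : Cb (Pop P X u (Qop (t - u) h)).
  apply: (@Pop_Cb _ _ e0 _ _ P F X rho) => //.
  by apply: bmeas_Qop => //; rewrite subr_gt0.
have /cvgrPdist_le/(_ (e / 3)) := cP x.
rewrite divr_gt0// => /(_ isT); apply: filterS => y.
have := close u y u0 ut; have := close u x u0 ut.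
move: (Qop t h x) (Qop t h y) (Pop _ _ _ _ x) (Pop _ _ _ _ y) => a1 a2 b1 b2.
rewrite !ler_norml => /andP[? ?] /andP[? ?] /andP[? ?]; apply/andP; split; lra.
Qed.

End FeynmanKac.

(** * The obstacle equation v = max(a Q v, g) *)

Lemma ler_dist_max {R : realDomainType} (a b a' b' : R) :
  `|Num.max a b - Num.max a' b'| <= `|a - a'| + `|b - b'|.
Proof.
have h (x y x' y' : R) : Num.max x y - Num.max x' y' <= `|x - x'| + `|y - y'|.
  have := ler_norm (x - x'); have := ler_norm (y - y').
  have := normr_ge0 (x - x'); have := normr_ge0 (y - y').
  have := lexx (Num.max x' y'); rewrite ge_max => /andP[].
  case: (lerP x y) => _; lra.
rewrite ler_norml lerNl opprB h andbT.
by rewrite (distrC a) (distrC b).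
Qed.

Section KilledResolvent.
Context {R : realType} {E : topologicalType} (e0 : E).
Notation EB := (borel_space e0).
Notation bE := (@bmeas _ EB R).
Variable Q : (E -> R) -> E -> R.
Hypotheses
  (Qlin : forall a (g h : E -> R) x, bE g -> bE h ->
     Q (fun y => a * g y + h y) x = a * Q g x + Q h x)
  (Qle : forall (g h : E -> R) x, bE g -> bE h -> (forall y, g y <= h y) ->
     Q g x <= Q h x)
  (Qnorm : forall (h : E -> R) (K : R) x, bE h -> (forall y, `|h y| <= K) ->
     `|Q h x| <= K)
  (Qcvg : forall (hn : nat -> E -> R) (h : E -> R) (K : R) x,
     (forall n, bE (hn n)) -> (forall n y, `|hn n y| <= K) ->
     (forall y, hn n y @[n --> \oo] --> h y) ->
     Q (hn n) x @[n --> \oo] --> Q h x)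
  (QCb : forall h : E -> R, bE h -> Cb (Q h)).

Lemma bmeas_Q h : bE h -> bE (Q h).
Proof. by move=> bh; apply: Cb_bmeas; exact: QCb. Qed.

Lemma bmeas_iterQ n h : bE h -> bE (iter n Q h).
Proof. by move=> bh; elim: n => //= n; exact: bmeas_Q. Qed.

Lemma iterQ_linear n a (g h : E -> R) x : bE g -> bE h ->
  iter n Q (fun y => a * g y + h y) x = a * iter n Q g x + iter n Q h x.
Proof.
move=> bg bh; elim: n x => //= n IH x.
rewrite -Qlin; [|exact: bmeas_iterQ..].
by congr (Q _ x); apply/funext => y; exact: IH.
Qed.

Lemma le_iterQ n (g h : E -> R) x : bE g -> bE h -> (forall y, g y <= h y) ->
  iter n Q g x <= iter n Q h x.
Proof.
move=> bg bh gh; elim: n x => //= n IH x.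
by apply: Qle => //; exact: bmeas_iterQ.
Qed.

Lemma iterQ_norm n (h : E -> R) (K : R) x : bE h -> (forall y, `|h y| <= K) ->
  `|iter n Q h x| <= K.
Proof.
by move=> bh hK; elim: n x => //= n IH x; apply: Qnorm => //; exact: bmeas_iterQ.
Qed.

Lemma iterQ_cvg n (hn : nat -> E -> R) (h : E -> R) (K : R) x :
  (forall m, bE (hn m)) -> (forall m y, `|hn m y| <= K) ->
  (forall y, hn m y @[m --> \oo] --> h y) ->
  iter n Q (hn m) x @[m --> \oo] --> iter n Q h x.
Proof.
move=> bh hK ch; elim: n x => //= n IH x.
apply: (@Qcvg (fun m => iter n Q (hn m)) _ K) => // m; first exact: bmeas_iterQ.
by move=> y; exact: iterQ_norm.
Qed.

Lemma iterQ0 n x : iter n Q (fun=> 0) x = 0.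
Proof.
apply/eqP; rewrite -normr_le0; apply: iterQ_norm; first exact: bmeas_cst.
by move=> y; rewrite normr0.
Qed.

Lemma iterQZ n a (h : E -> R) x : bE h ->
  iter n Q (fun y => a * h y) x = a * iter n Q h x.
Proof.
move=> bh; have b0 : bE (fun=> 0) by exact: bmeas_cst.
have := iterQ_linear n a x bh b0; rewrite iterQ0 addr0 => <-.
by congr (iter n Q _ x); apply/funext => y; rewrite addr0.
Qed.

Lemma Q_ge0 (h : E -> R) x : bE h -> (forall y, 0 <= h y) -> 0 <= Q h x.
Proof.
move=> bh h0; rewrite -(iterQ0 1 x); apply: Qle => //; exact: bmeas_cst.
Qed.

Lemma iterQ_ge0 n (h : E -> R) x : bE h -> (forall y, 0 <= h y) -> 0 <= iter n Q h x.
Proof.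
move=> bh h0; elim: n x => //= n IH x; apply: Q_ge0 => //; exact: bmeas_iterQ.
Qed.

Lemma QB (g h : E -> R) x : bE g -> bE h -> `|Q g x - Q h x| <= Q (fun y => `|g y - h y|) x.
Proof.
move=> bg bh.
have bgh : bE (fun y => `|g y - h y|) by apply: bmeas_norm; exact: bmeasB.
have dif (u v : E -> R) : bE u -> bE v -> (forall y, u y - v y <= `|g y - h y|) ->
    Q u x - Q v x <= Q (fun y => `|g y - h y|) x.
  move=> bu bv uv; rewrite lerBlDr -[X in _ <= X + _]mul1r -Qlin//.
  apply: Qle => //; first by apply: bmeasD => //; exact: bmeasZ.
  by move=> y; rewrite mul1r -lerBlDr.
rewrite ler_norml lerNl opprB; apply/andP; split; apply: dif => // y.
  by rewrite distrC ler_norm.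
exact: ler_norm.
Qed.

(** A discrete Duhamel formula: the inequality is substituted into itself N times, using positivity
    of [Q]. *)
Lemma subsolution_iter (a : R) (u g : E -> R) N x : 0 <= a -> bE u -> bE g ->
  (forall y, u y <= a * Q u y + g y) ->
  u x <= a ^+ N * iter N Q u x + \sum_(k < N) a ^+ k * iter k Q g x.
Proof.
move=> a0 bu bg ug; elim: N => [|N IH].
  by rewrite expr0 mul1r big_ord0 addr0.
apply: le_trans IH _.
rewrite big_ord_recr/= addrA [leRHS]addrAC lerD2r exprSr -mulrA -mulrDr.
rewrite ler_wpM2l ?exprn_ge0// -[Q (iter N Q u)]/(iter N.+1 Q u) iterSr -iterQ_linear//; last first.
  exact: bmeas_Q.
apply: le_iterQ => //; apply: bmeasD => //; apply: bmeasZ; exact: bmeas_Q.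
Qed.

Variable q : R.
Hypotheses (q_gt0 : 0 < q)
  (tail : forall eta : R, 0 < eta -> exists N, forall x, q ^+ N * iter N Q (fun=> 1) x <= eta).

Lemma le_cst_iterQ n (h : E -> R) (K : R) x : bE h -> (forall y, h y <= K) ->
  iter n Q h x <= K * iter n Q (fun=> 1) x.
Proof.
move=> bh hK; have b1 : bE (fun=> 1) by exact: bmeas_cst.
rewrite -iterQZ//; apply: le_iterQ => // [|y]; last by rewrite mulr1.
exact: bmeasZ.
Qed.

Lemma iterQ1_le1 n x : iter n Q (fun=> 1) x <= 1.
Proof.
apply: le_trans (ler_norm _) _; apply: iterQ_norm; first exact: bmeas_cst.
by move=> y; rewrite normr1.
Qed.

Lemma iterQ1_ge0 n x : 0 <= iter n Q (fun=> 1) x.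
Proof. by apply: iterQ_ge0 => //; exact: bmeas_cst. Qed.

(** As q may exceed 1, a single step need not contract. With N such that q^N Q^N 1 <= 1/2, iterating
    N times gives sup u <= sup u / 2 + S, and the finite supremum is absorbed. The resulting
    constant depends on q and N but not on [u], which is what makes it uniform over all
    solutions. *)
Lemma subsolution_bound : exists C : R, 1 <= C /\ forall u : E -> R, bE u ->
  (forall x, u x <= q * Q u x + 1) -> forall x, u x <= C.
Proof.
have half0 : 0 < 2^-1 :> R by rewrite invr_gt0.
have [N qN] := tail half0.
pose S := \sum_(k < N) q ^+ k.
exists (`|2 * S| + 1); split; first by rewrite lerDr.
move=> u bu uq; have [_ [K uK]] := bu.
have step_le (M : R) : (forall y, u y <= M) -> 0 <= M -> forall x, u x <= M / 2 + S.
  move=> uM M0 x.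
  have b1 : bE (fun=> 1) by exact: bmeas_cst.
  apply: le_trans (subsolution_iter N x (ltW q_gt0) bu b1 uq) _; apply: lerD.
    apply: (@le_trans _ _ (q ^+ N * (M * iter N Q (fun=> 1) x))).
      by rewrite ler_pM2l ?exprn_gt0//; exact: le_cst_iterQ.
    by rewrite mulrCA ler_wpM2l.
  apply: ler_sum => k _; by rewrite ler_piMr ?iterQ1_le1// exprn_ge0// ltW.
pose M := Num.max (sup (range u)) 0.
have uub : has_ubound (range u).
  by exists K => _ [y _ <-]; rewrite (le_trans (ler_norm _)).
have uM y : u y <= M.
  by rewrite le_max ub_le_sup//; exists y.
have M0 : 0 <= M by rewrite le_max lexx orbT.
have S0 : 0 <= S by apply: sumr_ge0 => k _; rewrite exprn_ge0// ltW.
have : M <= M / 2 + S.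
  rewrite ge_max; apply/andP; split; last by rewrite addr_ge0// divr_ge0.
  apply: ge_sup; first by exists (u e0), e0.
  by move=> _ [y _ <-]; exact: step_le.
move=> MS x; apply: le_trans (uM x) _.
have := ler_norm (2 * S); lra.
Qed.

(** Value iteration started at [g]. The iterates increase, so each of them is itself a subsolution
    with source 1, and all share the bound [C]. The limit inherits continuity from [Q w] and [g]. *)
Lemma obstacle_solution (a : R) (g : E -> R) : 0 <= a -> a <= q -> Cb g ->
  (forall x, 0 <= g x <= 1) ->
  exists v : E -> R, Cb v /\ forall x, v x = Num.max (a * Q v x) (g x).
Proof.
move=> a0 aq gC g01; have bg : bE g by exact: Cb_bmeas.
pose T (h : E -> R) x := Num.max (a * Q h x) (g x).
pose v n := iter n T g.
have bv n : bE (v n).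
  elim: n => //= n bn; apply: bmeas_max => //.
  by apply: bmeasZ; exact: bmeas_Q.
have vS n x : v n x <= v n.+1 x.
  elim: n x => [|n IH] x /=; first by rewrite /T le_max lexx orbT.
  rewrite /T ge_max !le_max lexx orbT andbT; apply/orP; left.
  by rewrite ler_wpM2l//; apply: Qle => //; exact: (bv n.+1).
have v0 n x : 0 <= v n x.
  case: n => [|n]; first by have /andP[] := g01 x.
  by rewrite /= /T le_max; apply/orP; right; have /andP[] := g01 x.
have [C [C1 HC]] := subsolution_bound.
have vC n x : v n x <= C.
  apply: HC => // {}x; apply: le_trans (vS n x) _.
  have Qv0 := Q_ge0 x (bv n) (v0 n).
  rewrite /= /T ge_max; apply/andP; split.
    by rewrite ler_wpDr// ler_wpM2r.
  have /andP[_ g1] := g01 x.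
  by rewrite ler_wpDl// mulr_ge0// ltW.
pose w x := lim (v n x @[n --> \oo]).
have cv x : v n x @[n --> \oo] --> w x.
  apply: nondecreasing_is_cvgn; first by apply/nondecreasing_seqP => n; exact: vS.
  by exists C => _ [n _ <-].
have vK n y : `|v n y| <= C by rewrite ger0_norm.
have cQ x : Q (v n) x @[n --> \oo] --> Q w x.
  by apply: (@Qcvg v _ C).
have bw : bE w by exact: bmeas_cvg bv vK cv.
have wE x : w x = Num.max (a * Q w x) (g x).
  have c1 : v n.+1 x @[n --> \oo] --> w x.
    by rewrite (cvg_shiftS (fun n => v n x)).
  have c2 : v n.+1 x @[n --> \oo] --> Num.max (a * Q w x) (g x).
    apply/cvgrPdist_le => e e_gt0.
    have cM : a * Q (v n) x @[n --> \oo] --> a * Q w x by apply: cvgMr; exact: cQ.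
    have /cvgrPdist_le/(_ _ e_gt0) := cM; apply: filterS => n.
    apply: le_trans; have := ler_dist_max (a * Q w x) (g x) (a * Q (v n) x) (g x).
    by rewrite subrr normr0 addr0.
  by rewrite -(cvg_lim _ c1)// -(cvg_lim _ c2).
exists w; split => //; split; last first.
  exists C => x _; apply: cvgr_to_le (cvg_norm (cv x)) _; exact: nearW.
have -> : w = (fun x => a * Q w x) \max g by apply/funext => x; exact: wE.
move=> x; apply: continuous_max; last exact: gC.1.
by apply: cvgMr; exact: (QCb bw).1.
Qed.

(* The error |v' - v| satisfies the subsolution inequality with source
   eps + C 1_{~` B}: outside B only the crude bound C is available. *)
Lemma solution_dist (a a' eps C : R) (B : set E) (g g' v v' : E -> R) N x :
  0 <= a -> a <= a' -> a' <= q -> a' - a <= eps -> closed B ->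
  bE v -> bE v' -> (forall y, 0 <= v y <= C) -> (forall y, 0 <= v' y <= C) ->
  (forall y, `|g' y - g y| <= eps) -> 
  (forall y, v y = Num.max (a * Q v y) (g y)) ->
  (forall y, B y -> v' y = Num.max (a' * Q v' y) (g' y)) ->
  `|v' x - v x| <= C * (q ^+ N * iter N Q (fun=> 1) x) +
    \sum_(k < N) q ^+ k * ((C + 1) * eps + C * iter k Q \1_(~` B) x).
Proof.
move=> a0 aa' a'q aeps cB bv bv' v0C v'0C geps vE v'E.
have eps0 : 0 <= eps by apply: le_trans aeps; rewrite subr_ge0.
have C0 : 0 <= C by have /andP[] := v0C x; exact: le_trans.
have aq : a <= q by exact: le_trans a'q.
pose h y := `|v' y - v y|.
have bh : bE h by apply: bmeas_norm; exact: bmeasB.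
have hC y : h y <= C.
  have := v0C y; have := v'0C y; rewrite /h ler_norml => /andP[? ?] /andP[? ?].
  by apply/andP; split; lra.
have bI : bE \1_(~` B).
  by apply: bmeas_indic; apply: borelEC; exact: closed_borelE.
(* Inside B, one [eps] pays for the change of obstacle and [C * eps] for replacing a' by a, since Q
   v' <= C. *)
pose G y := (C + 1) * eps + C * \1_(~` B) y.
have bG : bE G by apply: bmeasD; [exact: bmeas_cst|exact: bmeasZ].
have Qv'C y : Q v' y <= C.
  apply: le_trans (ler_norm _) _; apply: Qnorm => // z.
  by rewrite ger0_norm; have /andP[] := v'0C z.
have hG y : h y <= a * Q h y + G y.
  have Qh0 : 0 <= Q h y by apply: Q_ge0 => // z; exact: normr_ge0.
  have [By|nBy] := pselect (B y); last first.
    apply: le_trans (hC y) _; rewrite /G indicE mem_set// mulr1.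
    by rewrite addrA lerDr addr_ge0// mulr_ge0// addr_ge0.
  rewrite /G indicE memNset ?mulr0 ?addr0; last by apply.
  rewrite /h v'E// vE; apply: le_trans (ler_dist_max _ _ _ _) _.
  have -> : a' * Q v' y - a * Q v y = a * (Q v' y - Q v y) + (a' - a) * Q v' y by ring.
  have h1 : `|a * (Q v' y - Q v y)| <= a * Q h y.
    by rewrite normrM ger0_norm// ler_wpM2l//; exact: QB.
  have h2 : `|(a' - a) * Q v' y| <= eps * C.
    rewrite normrM ler_pM// ?ger0_norm ?subr_ge0//.
    by apply: Q_ge0 => // z; have /andP[] := v'0C z.
  have := ler_normD (a * (Q v' y - Q v y)) ((a' - a) * Q v' y).
  have := geps y; lra.
apply: le_trans (subsolution_iter N x a0 bh bG hG) _; apply: lerD.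
  rewrite mulrCA; apply: ler_pM; [exact: exprn_ge0|by apply: iterQ_ge0 => // y; exact: normr_ge0| |].
    by apply: lerXn2r; rewrite ?nnegrE// ltW.
  exact: le_cst_iterQ.
apply: ler_sum => k _; apply: ler_pM; [exact: exprn_ge0|apply: iterQ_ge0 => //| |].
- move=> y; rewrite /G addr_ge0 ?mulr_ge0 ?addr_ge0//.
- by apply: lerXn2r; rewrite ?nnegrE// ltW.
- have -> : iter k Q G x = iter k Q (fun y => C * \1_(~` B) y + (C + 1) * eps * 1) x.
    by congr (iter k Q _ x); apply/funext => y; rewrite /G addrC mulr1.
  rewrite iterQ_linear//; last exact: bmeas_cst.
  rewrite addrC iterQZ; last exact: bmeas_cst.
  by rewrite lerD2r ler_piMr ?iterQ1_le1// mulr_ge0// addr_ge0.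
Qed.

Lemma dini_outside (B : nat -> set E) (U : set E) (k : nat) (eta : R) :
  (forall m, closed (B m)) -> (forall m, B m `<=` B m.+1) ->
  \bigcup_m B m = setT -> compact U -> U `<=` B 0%N -> 0 < eta ->
  \forall m \near \oo, forall x, U x -> iter k Q \1_(~` B m) x <= eta.
Proof.
move=> cB BS BT cU UB eta0.
have Bmono m n : (m <= n)%N -> B m `<=` B n.
  elim: n => [|n IH]; first by rewrite leqn0 => /eqP ->.
  by rewrite leq_eqVlt => /predU1P[->//|mn] y /(IH mn); exact: BS.
have bI m : bE \1_(~` B m).
  by apply: bmeas_indic; apply: borelEC; exact: closed_borelE.
(* For k = 0 the indicator need not be continuous, but it vanishes on U. *)
case: k => [|k].
  apply: nearW => m x /UB Bx /=; rewrite indicE memNset ?ltW//.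
  by apply; exact: (Bmono 0%N).
have I1 m y : `|\1_(~` B m) y| <= 1 :> R.
  by rewrite indicE; case: (_ \in _); rewrite ?normr0 ?normr1.
have Imono m n y : (m <= n)%N -> \1_(~` B n) y <= \1_(~` B m) y :> R.
  move=> mn; rewrite !indicE; have [yn|_] := boolP (y \in ~` B n); last by rewrite ler0n.
  rewrite mem_set//; move/set_mem: yn; apply: contra_not; exact: Bmono.
have Icvg y : (\1_(~` B m) y : R) @[m --> \oo] --> (0 : R).
  have : (\bigcup_m B m) y by rewrite BT.
  move=> [m0 _ Bm0]; apply: cvg_near_cst; exists m0 => // m /= m0m.
  by rewrite indicE memNset//; apply; exact: Bmono Bm0.
have cvgI x : iter k.+1 Q \1_(~` B m) x @[m --> \oo] --> (0 : R).
  rewrite -(iterQ0 k.+1 x).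
  exact: (@iterQ_cvg k.+1 (fun m => \1_(~` B m)) (fun=> 0) 1).
have /compact_near_coveringP cUn := cU.
apply: (cUn _ \oo (fun m x => iter k.+1 Q \1_(~` B m) x <= eta)) => x Ux.
have /cvgrPdist_lt /(_ _ eta0)[m0 _ /(_ m0 (leqnn m0))] := cvgI x.
rewrite sub0r normrN => m0x.
have [cQk _] := QCb (bmeas_iterQ k (bI m0)).
have nx : nbhs x [set y | iter k.+1 Q \1_(~` B m0) y < eta].
  have /cvgr_lt := cQk x; apply; apply: le_lt_trans m0x; exact: ler_norm.
(* Continuity spreads the bound at m0 to a neighbourhood of x, and monotonicity in m extends it to
   every m >= m0: this is the product neighbourhood that the covering argument asks for. *)
exists ([set y | iter k.+1 Q \1_(~` B m0) y < eta], [set m | (m0 <= m)%N]) => /=.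
  by split=> //; exists m0.
move=> [y m] /= [ylt m0m]; apply: le_trans (ltW ylt).
apply: (@le_iterQ k.+1 _ _ y) => // z.
exact: Imono.
Qed.

(** The order of the quantifiers matters: [eps] and the threshold for m precede the coefficients,
    obstacles and solutions, because these will themselves change with m. *)
Lemma solution_stability (B : nat -> set E) (U : set E) (C eta : R) :
  (forall m, closed (B m)) -> (forall m, B m `<=` B m.+1) ->
  \bigcup_m B m = setT -> compact U -> U `<=` B 0%N -> 1 <= C -> 0 < eta ->
  exists2 eps, 0 < eps & \forall m \near \oo, forall (a a' : R) (g g' v v' : E -> R),
    0 <= a -> a <= a' -> a' <= q -> a' - a <= eps ->
    bE v -> bE v' -> (forall y, 0 <= v y <= C) -> (forall y, 0 <= v' y <= C) ->
    (forall y, `|g' y - g y| <= eps) ->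
    (forall y, v y = Num.max (a * Q v y) (g y)) ->
    (forall y, B m y -> v' y = Num.max (a' * Q v' y) (g' y)) ->
    forall x, U x -> `|v' x - v x| <= eta.
Proof.
move=> cB BS BT cU UB C1 eta0.
have C0 : 0 < C by lra.
(* Half of [eta] is spent on the tail after N steps, the other half, through [D], on the N source
   terms. In [D], [S + 1] replaces S, which is 0 if N = 0. *)
have e1 : 0 < eta / (2 * C) by rewrite divr_gt0// mulr_gt0.
have [N qN] := tail e1.
pose S := \sum_(k < N) q ^+ k.
have S0 : 0 <= S by apply: sumr_ge0 => k _; rewrite exprn_ge0// ltW.
pose D := (2 * C + 1) * (S + 1).
have D0 : 0 < D by rewrite mulr_gt0//; lra.
pose eps := eta / (2 * D).
have eps0 : 0 < eps by rewrite divr_gt0// mulr_gt0.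
exists eps => //.
have nearI : \forall m \near \oo, forall k : 'I_N, forall x, U x ->
    iter k Q \1_(~` B m) x <= eps.
  by apply: filter_forall => k; exact: dini_outside.
apply: filterS nearI => m mI a a' g g' v v' a0 aa' a'q aeps bv bv' v0 v0' geps vE v'E x Ux.
apply: le_trans (@solution_dist a a' eps C (B m) g g' v v' N x a0 aa' a'q aeps (cB m)
  bv bv' v0 v0' geps vE v'E) _.
have h1 : C * (q ^+ N * iter N Q (fun=> 1) x) <= eta / 2.
  have -> : eta / 2 = C * (eta / (2 * C)).
    by rewrite invfM mulrCA mulrA mulrACA mulfV ?mulr1// gt_eqF.
  by rewrite ler_pM2l.
have h2 : \sum_(k < N) q ^+ k * ((C + 1) * eps + C * iter k Q \1_(~` B m) x) <=
    S * ((2 * C + 1) * eps).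
  rewrite mulr_suml; apply: ler_sum => k _; rewrite ler_wpM2l//.
    by rewrite exprn_ge0// ltW.
  have : C * iter k Q \1_(~` B m) x <= C * eps by rewrite ler_pM2l//; exact: mI.
  by lra.
have h3 : S * ((2 * C + 1) * eps) <= eta / 2.
  have -> : eta / 2 = D * eps.
    by rewrite /eps invfM mulrCA mulrA mulrACA mulfV ?mulr1// gt_eqF.
  by rewrite /D mulrA ler_pM2r// mulrC ler_wpM2l//; lra.
by lra.
Qed.

End KilledResolvent.

(** * Optimal stopping *)

(** If nothing is found, [find] returns the length N; hence the value N carries no condition on
    [p N]. *)
Lemma find_iotaP (p : pred nat) (N k : nat) :
  (find p (iota 0 N) == k) = [&& (k <= N)%N, ~~ has p (iota 0 k) & (k < N)%N ==> p k].
Proof.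
apply/eqP/and3P => [<-|[kN hk pk]].
  split; first by rewrite -[leqRHS](size_iota 0 N) find_size.
    apply/hasP => - [j]; rewrite mem_iota add0n => /= jf pj.
    have := before_find 0%N jf; rewrite nth_iota ?pj//.
    by rewrite (leq_trans jf)// -[leqRHS](size_iota 0 N) find_size.
  apply/implyP; rewrite -[X in (_ < X)%N](size_iota 0 N) -has_find => hp.
  have := nth_find 0%N hp; rewrite nth_iota ?add0n//.
  by rewrite -[X in (_ < X)%N](size_iota 0 N) -has_find.
rewrite -(subnKC kN) iotaD find_cat (negbTE hk) size_iota add0n.
move: pk; case: ltnP => [kN'|]; last first.
  by rewrite -subn_eq0 => /eqP -> _; rewrite /= addn0.
move: kN'; rewrite -subn_gt0.
by case: (N - k)%N => //= n _ ->; rewrite addn0.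
Qed.

Section OptimalStopping.
Context {R : realType} {E : topologicalType} (e0 : E) {d : measure_display}
  {Omega : measurableType d}.
Variables (P : E -> probability Omega R) (F : R -> set (set Omega))
  (X : R -> Omega -> E) (rho : E -> E -> R) (f : E -> R) (Kf : R).
Hypotheses (rhoP : metric_inducing rho) (HF : is_filtration F)
  (HA : adapted F X) (HC : cadlag_paths X) (HN : normal_process P X)
  (HS : strong_Markov P F X) (H2 : A2 P X)
  (fcont : continuous f) (f_le0 : forall x, f x <= 0)
  (f_norm : forall x, `|f x| <= Kf).
Variables (delta lam : R).
Hypothesis delta_gt0 : 0 < delta.
Notation EB := (borel_space e0).
Notation bE := (@bmeas _ EB R).
Notation bF t := (@bmeas _ (g_sigma_algebraType (F t)) R).
Let a : R := expR (- (lam * delta)).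
Local Notation Q := (Qop P X f delta).

Lemma pathint_shift t w : 0 <= t ->
  pathint X (fun y => f y - lam) t w = pathint X f t w - lam * t.
Proof.
rewrite le_eqVlt => /predU1P[<-|t0].
  by rewrite /pathint !set_itv1 !Rintegral_set1 mulr0 subrr.
have r1 : right_cts (fun s => f (X s w)) by exact: path_right_cts HC fcont _.
have r2 : right_cts (fun s => f (X s w) - lam).
  by move=> u u0; apply: cvgB; [exact: r1|exact: cvg_cst].
have n1 u : `|f (X u w)| <= Kf by [].
have n2 u : `|f (X u w) - lam| <= Kf + `|lam|.
  by apply: le_trans (ler_normB _ _) _; rewrite lerD2r.
have e (phi : R -> R) (K : R) : right_cts phi -> (forall u, `|phi u| <= K) ->
    Rintegral (@lebesgue_measure R) `[0, t]%classic phi =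
    Rintegral (@lebesgue_measure R) `]0, (0 + t)%R]%classic phi.
  move=> rphi phiK; have := Rintegral_right_cts_split (lexx 0) t0 rphi phiK.
  by rewrite add0r set_itv1 Rintegral_set1 subr0.
rewrite /pathint (e _ _ r1 n1) (e _ _ r2 n2).
have c1 := @riemann_sum_cvg _ 0 t _ _ (lexx 0) t0 r1 n1.
have c2 := @riemann_sum_cvg _ 0 t _ _ (lexx 0) t0 r2 n2.
have c3 : \sum_(i < n.+1) t / n.+1%:R * f (X (0 + i.+1%:R * (t / n.+1%:R)) w) - lam * t
    @[n --> \oo] --> Rintegral (@lebesgue_measure R) `]0, (0 + t)%R]%classic
      (fun s => f (X s w)) - lam * t.
  by apply: cvgB => //; exact: cvg_cst.
move: c2; rewrite (_ : (fun n : nat => _) = (fun n : nat =>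
    \sum_(i < n.+1) t / n.+1%:R * f (X (0 + i.+1%:R * (t / n.+1%:R)) w) - lam * t)).
  by move=> c2; rewrite -(cvg_lim _ c2)// -(cvg_lim _ c3).
apply/funext => n.
have -> : lam * t = \sum_(i < n.+1) t / n.+1%:R * lam.
  rewrite sumr_const card_ord -(mulr_natr (t / _ * _)) mulrAC divfK ?pnatr_eq0//.
  by rewrite mulrC.
by rewrite -sumrB; apply: eq_bigr => i _; rewrite mulrBr.
Qed.

Variables (v g : E -> R) (c : R).
Hypotheses (bv : bE v) (bg : bE g) (c_gt0 : 0 < c) (g_ge : forall x, c <= g x)
  (vE : forall x, v x = Num.max (a * Q v x) (g x)).

Let T (k : nat) : R := k%:R * delta.
(** The discount exp(int_0^{T k} (f - lam)), with its constant part pulled out as a power of [a]. *)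
Let Y (k : nat) (w : Omega) : R := a ^+ k * expR (pathint X f (T k) w).

Let T_ge0 k : 0 <= T k. Proof. by rewrite /T mulr_ge0// ltW. Qed.

Let T_S k : T k.+1 = T k + delta. Proof. by rewrite /T -natr1 mulrDl mul1r. Qed.

Let T_le k n : (k <= n)%N -> T k <= T n.
Proof. by move=> kn; rewrite /T ler_pM2r// ler_nat. Qed.

Let a_gt0 : 0 < a. Proof. exact: expR_gt0. Qed.

Let Y_ge0 k w : 0 <= Y k w.
Proof. by rewrite /Y mulr_ge0 ?expR_ge0// exprn_ge0// ltW. Qed.

Let bY k : bF (T k) (Y k).
Proof.
apply: bmeasZ; apply: bmeas_expR.
exact: (@bF_pathint _ _ e0 _ _ F X f Kf).
Qed.

Let bQv : bE (Q v).
Proof. exact: (@bmeas_Qop _ _ e0 _ _ P F X rho f Kf). Qed.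

Let bX k h : bE h -> bF (T k) (fun w => h (X (T k) w)).
Proof. exact: (@bF_X _ _ e0 _ _ F X). Qed.

Let bO k (Z : Omega -> R) : bF (T k) Z -> bmeas Z.
Proof. exact: (bF_bmeas HF). Qed.

Section Stopping.
Variable tau : Omega -> option nat.
Hypothesis tauF : forall k : nat, F (k%:R * delta) [set w | tau w = Some k].

Let e k : Omega -> R := \1_[set w | tau w = Some k].
(** The indicator of tau >= n, with [None] counted as infinity. The shift matters: [Z n.+1] is
    already known at time [T n], which permits the Markov step from [T n] to [T n.+1]. *)
Let Z n w : R := 1 - \sum_(k < n) e k w.

Lemma tau_sum (A : nat -> R) n w : \sum_(k < n) e k w * A k =
  if tau w is Some j then (if (j < n)%N then A j else 0) else 0.
Proof.
have eE k : e k w = (tau w == Some k)%:R.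
  by rewrite /e indicE; case: eqP => h; [rewrite mem_set|rewrite memNset].
case E1 : (tau w) => [j|]; last first.
  by rewrite big1// => k _; rewrite eE E1 mul0r.
case: ltnP => jn.
  rewrite (bigD1 (Ordinal jn))//= eE E1 eqxx mul1r big1 ?addr0// => k kj.
  rewrite eE E1 (_ : _ == _ = false) ?mul0r//.
  by apply/eqP => - [jk]; move: kj; rewrite -val_eqE/= jk eqxx.
rewrite big1// => k _; rewrite eE E1 (_ : _ == _ = false) ?mul0r//.
by apply/eqP => - [jk]; move: (ltn_ord k); rewrite -jk ltnNge jn.
Qed.

Lemma Z_eq n w : Z n w = if tau w is Some j then (n <= j)%N%:R else 1.
Proof.
have := tau_sum (fun=> 1) n w; under eq_bigr do rewrite mulr1.
rewrite /Z => ->; case: (tau w) => [j|]; last by rewrite subr0.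
by case: ltnP => _; rewrite ?subrr ?subr0.
Qed.

Let e_ge0 k w : 0 <= e k w.
Proof. by rewrite /e indicE; case: (_ \in _). Qed.

Let Z_ge0 n w : 0 <= Z n w.
Proof. by rewrite Z_eq; case: (tau w) => [j|//]; case: (_ <= _)%N. Qed.

Let be k : bF (T k) (e k).
Proof.
by apply: bmeas_indic; rewrite (Ft_measurable HF) ?T_ge0//; exact: tauF.
Qed.

Let bZ n : bF (T n) (Z n.+1).
Proof.
apply: bmeasB; first exact: bmeas_cst.
apply: bmeas_sum => k; apply: (@bF_le _ _ _ _ HF (T k)) => //.
by apply: T_le; rewrite -ltnS.
Qed.

Let bZ0 n : bmeas (Z n).
Proof.
case: n => [|n]; last exact: (bO (bZ n)).
rewrite (_ : Z 0 = fun=> 1); first exact: bmeas_cst.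
by apply/funext => w; rewrite /Z big_ord0 subr0.
Qed.

Let bYX k h : bE h -> bF (T k) (fun w => Y k w * h (X (T k) w)).
Proof. by move=> bh; apply: bmeasM; [exact: bY|exact: bX]. Qed.

(** The reward [g] is collected if tau < n, and the game is sold for [v] at time [T n] otherwise.
    This interpolates between [v x] at n = 0 and the mean payoff of a bounded time. *)
Definition stopped_value n x : R :=
  \sum_(k < n) mean (P x) (fun w => e k w * (Y k w * g (X (T k) w))) +
  mean (P x) (fun w => Z n w * (Y n w * v (X (T n) w))).

Lemma stopped_value0 x : stopped_value 0 x = v x.
Proof.
rewrite /stopped_value big_ord0 add0r -[RHS](@mean_X0 _ _ e0 _ _ P F X rho)//.
congr (mean _ _); apply/funext => w.
rewrite /Z big_ord0 subr0 mul1r /Y expr0 mul1r /T mul0r.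
by rewrite (@pathint0 _ _ _ _ X f) expR0 mul1r.
Qed.

(** The loss in one step splits in two: stopping where v exceeds g, and continuing where v exceeds a
    Q v. Both parts are nonnegative for any tau and vanish for an optimal one. *)
Lemma stopped_value_step n x : stopped_value n x = stopped_value n.+1 x +
  mean (P x) (fun w => e n w * (Y n w * (v (X (T n) w) - g (X (T n) w)))) +
  mean (P x) (fun w => Z n.+1 w * (Y n w * (v (X (T n) w) - a * Q v (X (T n) w)))).
Proof.
have baQ : bE (fun y => a * Q v y) by exact: bmeasZ.
have eYh h : bE h -> bmeas (fun w => e n w * (Y n w * h (X (T n) w))).
  by move=> bh; apply: (@bO n); apply: bmeasM; [exact: be|exact: bYX].
have zYh h : bE h -> bmeas (fun w => Z n.+1 w * (Y n w * h (X (T n) w))).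
  by move=> bh; apply: (@bO n); apply: bmeasM; [exact: bZ|exact: bYX].
have m1 : mean (P x) (fun w => Z n.+1 w * (Y n.+1 w * v (X (T n.+1) w))) =
    mean (P x) (fun w => Z n.+1 w * (Y n w * (a * Q v (X (T n) w)))).
  have := @mean_Markov _ _ e0 _ _ P F X rho f Kf rhoP HF HA HC HN HS H2 fcont
    f_le0 f_norm (T n) delta (Z n.+1) v x (T_ge0 n) delta_gt0 (bZ n) bv.
  rewrite -T_S => mk.
  transitivity (a ^+ n.+1 * mean (P x) (fun w => Z n.+1 w *
      expR (pathint X f (T n.+1) w) * v (X (T n.+1) w))).
    rewrite -meanZ.
      congr (mean _ _); apply/funext => w; rewrite /Y.
      by rewrite !mulrA [a ^+ _ * Z _ _]mulrC.
    apply: bmeasM; last exact: (bO (bX n.+1 bv)).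
    apply: bmeasM; first exact: bZ0.
    by apply: bmeas_expR; apply: (bO (k := n.+1)); exact: (@bF_pathint _ _ e0 _ _ F X f Kf).
  rewrite mk -meanZ; last first.
    apply: bmeasM; last exact: (bO (bX n bQv)).
    apply: bmeasM; first exact: bZ0.
    by apply: bmeas_expR; apply: (bO (k := n)); exact: (@bF_pathint _ _ e0 _ _ F X f Kf).
  by congr (mean _ _); apply/funext => w; rewrite /Y exprS; ring.
rewrite /stopped_value big_ord_recr/= m1.
have s1 : mean (P x) (fun w => e n w * (Y n w * (v (X (T n) w) - g (X (T n) w)))) =
    mean (P x) (fun w => e n w * (Y n w * v (X (T n) w))) -
    mean (P x) (fun w => e n w * (Y n w * g (X (T n) w))).
  rewrite -meanB; [|exact: eYh..].
  by congr (mean _ _); apply/funext => w; ring.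
have s2 : mean (P x) (fun w => Z n.+1 w * (Y n w * (v (X (T n) w) - a * Q v (X (T n) w)))) =
    mean (P x) (fun w => Z n.+1 w * (Y n w * v (X (T n) w))) -
    mean (P x) (fun w => Z n.+1 w * (Y n w * (a * Q v (X (T n) w)))).
  rewrite -meanB; [|exact: zYh|exact: (zYh (fun y => a * Q v y))].
  by congr (mean _ _); apply/funext => w; ring.
have s3 : mean (P x) (fun w => Z n w * (Y n w * v (X (T n) w))) =
    mean (P x) (fun w => Z n.+1 w * (Y n w * v (X (T n) w))) +
    mean (P x) (fun w => e n w * (Y n w * v (X (T n) w))).
  rewrite -meanD; [|exact: zYh|exact: eYh].
  congr (mean _ _); apply/funext => w.
  by rewrite /Z big_ord_recr/=; ring.
rewrite s1 s2 s3; ring.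
Qed.

Lemma le_stopped_value n x : stopped_value n x <= v x.
Proof.
rewrite -(stopped_value0 x); elim: n => // n IH; apply: le_trans IH.
rewrite [leRHS]stopped_value_step -addrA lerDl addr_ge0//; apply: mean_ge0 => w.
  apply: mulr_ge0; first exact: e_ge0.
  apply: mulr_ge0; first exact: Y_ge0.
  by rewrite subr_ge0 [leRHS]vE le_max lexx orbT.
apply: mulr_ge0; first exact: Z_ge0.
apply: mulr_ge0; first exact: Y_ge0.
by rewrite subr_ge0 [leRHS]vE le_max lexx.
Qed.

Lemma eq_stopped_value N x :
  (forall w k, tau w = Some k -> (k < N)%N -> v (X (T k) w) = g (X (T k) w)) ->
  (forall w k, Z k.+1 w != 0 -> (k < N)%N -> v (X (T k) w) = a * Q v (X (T k) w)) ->
  stopped_value N x = v x.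
Proof.
move=> H1 H3; rewrite -(stopped_value0 x).
suff : forall n, (n <= N)%N -> stopped_value n x = stopped_value 0 x by exact.
elim=> // n IH nN; rewrite -IH; last exact: ltnW.
rewrite [RHS]stopped_value_step.
have -> : (fun w => e n w * (Y n w * (v (X (T n) w) - g (X (T n) w)))) = fun=> 0.
  apply/funext => w; rewrite /e indicE; have [/set_mem tw|_] := boolP (_ \in _).
    by rewrite (H1 w n)// subrr !mulr0.
  by rewrite mul0r.
have -> : (fun w => Z n.+1 w * (Y n w * (v (X (T n) w) - a * Q v (X (T n) w)))) = fun=> 0.
  apply/funext => w; have [->|Zw] := eqVneq (Z n.+1 w) 0; first by rewrite mul0r.
  by rewrite {1}(H3 w n)// subrr !mulr0.
by rewrite !mean_cst !addr0.
Qed.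

Definition payoff (w : Omega) : R :=
  if tau w is Some k then Y k w * g (X (T k) w) else 0.

Lemma payoff_partial n w : \sum_(k < n) e k w * (Y k w * g (X (T k) w)) =
  if tau w is Some j then (if (j < n)%N then payoff w else 0) else 0.
Proof.
rewrite (tau_sum (fun k => Y k w * g (X (T k) w))) /payoff.
by case: (tau w).
Qed.

Let b_partial k : bmeas (fun w => e k w * (Y k w * g (X (T k) w))).
Proof. by apply: (@bO k); apply: bmeasM; [exact: be|exact: bYX]. Qed.

Let b_partials n :
  bmeas (fun w => \sum_(k < n) e k w * (Y k w * g (X (T k) w))).
Proof. by apply: bmeas_sum => k; exact: b_partial. Qed.

Lemma measurable_payoff : measurable_fun setT payoff.
Proof.
apply: (measurable_fun_cvg
  (h := fun n w => \sum_(k < n) e k w * (Y k w * g (X (T k) w)))) => [n|w _].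
  exact: (b_partials _).1.
under eq_fun do rewrite payoff_partial.
rewrite /payoff; case: (tau w) => [j|]; last exact: cvg_cst.
by apply: cvg_near_cst; exists j.+1 => // n /= jn; rewrite jn.
Qed.

Lemma mean_payoff N x : P x [set w | exists k, tau w = Some k /\ (k <= N)%N] = 1%E ->
  mean (P x) payoff = \sum_(k < N.+1) mean (P x) (fun w => e k w * (Y k w * g (X (T k) w))).
Proof.
move=> PN; rewrite -mean_sum//.
have mA : measurable [set w | exists k, tau w = Some k /\ (k <= N)%N].
  rewrite (_ : [set _ | _] = \bigcup_(k in [set k | (k <= N)%N]) [set w | tau w = Some k]).
    apply: bigcup_measurable => k _; apply: (HF.1 _ (T_ge0 k)).2; exact: tauF.
  by apply/seteqP; split=> [w [k [h1 h2]]|w [k h1 h2]]; exists k.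
apply: eq_mean_prob1 mA PN measurable_payoff _ _.
  exact: (b_partials _).1.
by move=> w [k [tw kN]]; rewrite payoff_partial tw ltnS kN.
Qed.

Lemma mean_payoff_le N x :
  P x [set w | exists k, tau w = Some k /\ (k <= N)%N] = 1%E ->
  mean (P x) payoff <= v x.
Proof.
move=> PN; rewrite (mean_payoff PN); apply: le_trans (le_stopped_value N.+1 x).
rewrite /stopped_value lerDl; apply: mean_ge0 => w.
have v0 y : 0 <= v y by rewrite vE le_max (ltW (lt_le_trans c_gt0 (g_ge y))) orbT.
apply: mulr_ge0; first exact: Z_ge0.
by apply: mulr_ge0; first exact: Y_ge0.
Qed.

(** Positivity is what lets [ln] preserve inequalities. On tau <= N the discount is at least m^N,
    where m is the worst discount of one step, capped at 1 so that its powers decrease. *)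
Lemma mean_payoff_gt0 N x :
  P x [set w | exists k, tau w = Some k /\ (k <= N)%N] = 1%E ->
  0 < mean (P x) payoff.
Proof.
move=> PN; have mA : measurable [set w | exists k, tau w = Some k /\ (k <= N)%N].
  rewrite (_ : [set _ | _] = \bigcup_(k in [set k | (k <= N)%N]) [set w | tau w = Some k]).
    apply: bigcup_measurable => k _; apply: (HF.1 _ (T_ge0 k)).2; exact: tauF.
  by apply/seteqP; split=> [w [k [h1 h2]]|w [k h1 h2]]; exists k.
have Kf0 : 0 <= Kf by exact: le_trans (f_norm e0).
pose r := a * expR (- (Kf * delta)).
have r0 : 0 < r by rewrite mulr_gt0// expR_gt0.
pose m := Num.min 1 r.
have m0 : 0 < m by rewrite lt_min ltr01.
have m1 : m <= 1 by rewrite ge_min lexx.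
have Ym k w : (k <= N)%N -> m ^+ N <= Y k w.
  move=> kN; apply: (@le_trans _ _ (m ^+ k)); first by rewrite ler_wiXn2l ?(ltW m0).
  apply: (@le_trans _ _ (r ^+ k)).
    by apply: lerXn2r; rewrite ?nnegrE ?(ltW m0) ?(ltW r0)// ge_min lexx orbT.
  rewrite /r exprMn ler_pM2l ?exprn_gt0// -expRM_natl ler_expR.
  have := @pathint_bounds _ _ _ _ X f Kf HC fcont f_le0 f_norm (T k) w (T_ge0 k).
  by move=> /andP[h _]; apply: le_trans h; rewrite /T; lra.
have mc0 : 0 < m ^+ N * c by rewrite mulr_gt0// exprn_gt0.
have bce : bmeas (fun w => \sum_(k < N.+1) m ^+ N * c * e k w).
  by apply: bmeas_sum => k; apply: bmeasZ; exact: (bO (be k)).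
apply: lt_le_trans mc0 _; rewrite (mean_payoff PN) -mean_sum//.
rewrite -[leLHS](mean_cst (P x)).
rewrite (@eq_mean_prob1 _ _ _ _ (fun=> m ^+ N * c)
  (fun w => \sum_(k < N.+1) m ^+ N * c * e k w) _ mA PN).
- apply: le_mean => [||w].
  + exact: bce.
  + exact: b_partials.
  + apply: ler_sum => k _; rewrite mulrC ler_wpM2l//.
    apply: ler_pM; [exact/exprn_ge0/ltW|exact: ltW| |exact: g_ge].
    by apply: Ym; rewrite -ltnS.
- exact: measurable_cst.
- exact: bce.1.
- move=> w [k [tw kN]]; have := tau_sum (fun=> m ^+ N * c) N.+1 w.
  by rewrite tw ltnS kN => h; rewrite -[LHS]h; apply: eq_bigr => i _; rewrite mulrC.
Qed.

End Stopping.

Lemma Qop_iter n h x : bE h -> Qop P X f (T n) h x = iter n Q h x.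
Proof.
elim: n h => [|n IH] h bh.
  rewrite /= -[RHS](@mean_X0 _ _ e0 _ _ P F X rho)//; congr (mean _ _).
  by apply/funext => w; rewrite /T mul0r (@pathint0 _ _ _ _ X f) expR0 mul1r.
rewrite T_S (@Qop_semigroup _ _ e0 _ _ P F X rho f Kf)// iterSr IH//.
exact: (@bmeas_Qop _ _ e0 _ _ P F X rho f Kf).
Qed.

(** The truncation at N is the default value of [find]: N is returned when v > g at all earlier
    times. *)
Definition first_contact N w : option nat :=
  Some (find (fun k => v (X (T k) w) <= g (X (T k) w)) (iota 0 N)).

Lemma first_contactP N w k : first_contact N w = Some k <->
  [/\ (k <= N)%N, forall j, (j < k)%N -> g (X (T j) w) < v (X (T j) w) &
      (k < N)%N -> v (X (T k) w) <= g (X (T k) w)].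
Proof.
rewrite /first_contact; split => [[/eqP]|[kN h1 h2]].
  rewrite find_iotaP => /and3P[kN /hasPn h1 /implyP h2]; split => // j jk.
  by rewrite ltNge; apply: h1; rewrite mem_iota.
congr Some; apply/eqP; rewrite find_iotaP kN/=; apply/andP; split; last exact/implyP.
by apply/hasPn => j; rewrite mem_iota add0n -ltNge => /h1.
Qed.

Lemma first_contact_F N k : F (k%:R * delta) [set w | first_contact N w = Some k].
Proof.
have t0 : 0 <= k%:R * delta by exact: (T_ge0 k).
rewrite -(Ft_measurable HF t0).
have D j : (j <= k)%N -> @measurable _ (g_sigma_algebraType (F (k%:R * delta)))
    [set w | v (X (T j) w) <= g (X (T j) w)].
  move=> jk; have b : bF (k%:R * delta) (fun w => v (X (T j) w) - g (X (T j) w)).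
    apply: (@bF_le _ _ _ _ HF (T j)) => //; first exact: (T_le jk).
    by apply: bmeasB; exact: bX.
  have := b.1 measurableT `]-oo, 0]%classic (measurable_itv _).
  rewrite setTI; congr measurable; apply/seteqP.
  by split=> w /=; rewrite in_itv/= subr_le0.
have [kN|Nk] := leqP k N; last first.
  rewrite (_ : [set _ | _] = set0); first exact: measurable0.
  by apply/seteqP; split=> w // /first_contactP[]; rewrite leqNgt Nk.
rewrite (_ : [set _ | _] =
    (\bigcap_(j in [set j | (j < k)%N]) ~` [set w | v (X (T j) w) <= g (X (T j) w)]) `&`
    [set w | (k < N)%N -> v (X (T k) w) <= g (X (T k) w)]).
  apply: measurableI.
    by apply: bigcap_measurableType => j /= jk; apply: measurableC; apply: D; exact: ltnW.
  have [kN'|Nk] := boolP (k < N)%N.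
    rewrite (_ : [set _ | _] = [set w | v (X (T k) w) <= g (X (T k) w)]); first exact: D.
    by apply/seteqP; split=> w /=; auto.
  rewrite (_ : [set _ | _] = setT); first exact: measurableT.
  by apply/seteqP; split=> w.
apply/seteqP; split=> w /=.
  move=> /first_contactP[_ h1 h2]; split=> // j /= jk.
  by apply/negP; rewrite -ltNge; exact: h1.
move=> [h1 h2]; apply/first_contactP; split=> // j jk.
by rewrite ltNge; apply/negP; exact: h1.
Qed.

Lemma first_contact_dyadic N x :
  P x [set w | exists k, first_contact N w = Some k /\ (k <= N)%N] = 1%E.
Proof.
rewrite (_ : [set _ | _] = setT); first exact: probability_setT.
apply/seteqP; split=> // w _; eexists; split; first by [].
by rewrite -[leqRHS](size_iota 0 N) find_size.
Qed.

Lemma mean_payoff_first_contact N x C : (forall y, v y <= C) ->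
  v x - C * (a ^+ N * iter N Q (fun=> 1) x) <= mean (P x) (payoff (first_contact N)).
Proof.
move=> vC.
have v0 y : 0 < v y by rewrite vE lt_max (lt_le_trans c_gt0 (g_ge y)) orbT.
have C0 : 0 < C by exact: lt_le_trans (v0 x) (vC x).
have tF := first_contact_F N.
rewrite (mean_payoff tF (first_contact_dyadic N x)) big_ord_recr/=.
(* Before N this time stops only where v = g and goes on only where v = a Q v, so no step loses
   anything. *)
have <- : stopped_value (first_contact N) N x = v x.
  apply: (eq_stopped_value tF) => w k.
    move=> /first_contactP[_ _ h] kN; apply/eqP; rewrite eq_le h//=.
    by rewrite [leRHS]vE le_max lexx orbT.
  rewrite Z_eq /first_contact.
  set j := find _ _; have /first_contactP[jN h1 h2] : first_contact N w = Some j by [].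
  case: ltnP => [kj _ kN|]; last by rewrite eqxx.
  have := h1 k kj; rewrite {1}vE lt_max ltxx orbF => gQ.
  by rewrite [LHS]vE max_l// ltW.
rewrite /stopped_value -addrA lerD2l.
(* Both sides are compared with 0: on the left, v at time N is charged at its maximal value C; on
   the right, the reward collected at N is nonnegative. *)
apply: (@le_trans _ _ 0).
  rewrite subr_le0 -(@Qop_iter N (fun=> 1)); last exact: bmeas_cst.
  have bp : bmeas (fun w => expR (pathint X f (T N) w) * 1).
    apply: bmeasM; last exact: bmeas_cst.
    by apply: bmeas_expR; apply: (bO (k := N)); exact: (@bF_pathint _ _ e0 _ _ F X f Kf).
  rewrite /Qop mulrA -meanZ//; apply: le_mean => [||w]; last first.
  - rewrite mulr1 /Y [C * _]mulrC [leRHS]mulrAC.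
    rewrite mulrCA; apply: (@le_trans _ _ (a ^+ N * expR (pathint X f (T N) w) * v (X (T N) w))).
      rewrite mulrCA ler_piMl//; last by rewrite Z_eq; case: (first_contact N w) => // j; case: (_ <= _)%N.
      by apply: mulr_ge0; [exact: Y_ge0|exact: ltW].
    by rewrite ler_wpM2l//; exact: Y_ge0.
  - exact: bmeasZ.
  - apply: bmeasM; last first.
      by apply: (@bO N); apply: bmeasM; [exact: bY|exact: bX].
    apply: bmeasB; first exact: bmeas_cst.
    apply: bmeas_sum => k; apply: bmeas_indic; exact: (HF.1 _ (T_ge0 k)).2 (tF k).
apply: mean_ge0 => w; apply: mulr_ge0.
  by rewrite indicE; case: (_ \in _).
apply: mulr_ge0; first exact: Y_ge0.
exact/ltW/(lt_le_trans c_gt0).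
Qed.

End OptimalStopping.

(** * The impulse operator and compactness *)

Section SupOverCompact.
Context {R : realType} {E : topologicalType} (U : set E).
Hypothesis U0 : U !=set0.
Implicit Types p q : E -> R.

Lemma le_sup_image p (K : R) xi : (forall x, U x -> p x <= K) -> U xi ->
  p xi <= sup [set p x | x in U].
Proof.
move=> pK Uxi; apply: ub_le_sup; last by exists xi.
by exists K => _ [x Ux <-]; exact: pK.
Qed.

Lemma sup_image_le p (K : R) : (forall x, U x -> p x <= K) -> sup [set p x | x in U] <= K.
Proof.
move=> pK; apply: ge_sup; first by have [x Ux] := U0; exists (p x), x.
by move=> _ [x Ux <-]; exact: pK.
Qed.

Lemma sup_image_dist p q (K e : R) :
  (forall x, U x -> p x <= K) -> (forall x, U x -> q x <= K) ->
  (forall x, U x -> `|p x - q x| <= e) ->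
  `|sup [set p x | x in U] - sup [set q x | x in U]| <= e.
Proof.
have h p' q' : (forall x, U x -> q' x <= K) -> (forall x, U x -> `|p' x - q' x| <= e) ->
    sup [set p' x | x in U] - sup [set q' x | x in U] <= e.
  move=> q'K d'; rewrite lerBlDr; apply: sup_image_le => x Ux.
  have := le_sup_image q'K Ux; have := d' x Ux; rewrite ler_norml => /andP[_].
  lra.
move=> pK qK pq; rewrite ler_norml lerNl opprB !h//.
by move=> x Ux; rewrite distrC pq.
Qed.

End SupOverCompact.

Section ImpulseOperator.
Context {R : realType} {E : topologicalType} (U : set E) (c : E -> E -> R) (Kc : R).
Hypotheses (U0 : U !=set0) (cK : forall x xi, U xi -> `|c x xi| <= Kc).
Implicit Types h : E -> R.

Lemma Mop_summand_le h (K : R) x xi : (forall z, U z -> h z <= K) -> U xi ->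
  c x xi + h xi <= Kc + K.
Proof.
by move=> hK Uxi; apply: lerD; [exact: le_trans (ler_norm _) (cK _ _)|exact: hK].
Qed.

Lemma Mop_ge h (K : R) x xi : (forall z, U z -> h z <= K) -> U xi ->
  c x xi + h xi <= Mop U c h x.
Proof.
move=> hK Uxi; apply: (@le_sup_image _ _ U (fun xi => c x xi + h xi) (Kc + K)) => //.
by move=> z Uz; exact: Mop_summand_le.
Qed.

Lemma Mop_le h (b : R) x : (forall xi, U xi -> c x xi + h xi <= b) -> Mop U c h x <= b.
Proof. by move=> hb; exact: (sup_image_le U0). Qed.

Lemma Mop_dist h h' (K e : R) x : (forall z, U z -> h z <= K) ->
  (forall z, U z -> h' z <= K) -> (forall z, U z -> `|h z - h' z| <= e) ->
  `|Mop U c h x - Mop U c h' x| <= e.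
Proof.
move=> hK h'K hh'; apply: (@sup_image_dist _ _ U U0 _ _ (Kc + K)) => [z Uz|z Uz|z Uz].
- exact: Mop_summand_le.
- exact: Mop_summand_le.
- by rewrite opprD addrACA subrr add0r hh'.
Qed.

Lemma Mop_equi h (K e : R) x y : (forall z, U z -> h z <= K) ->
  (forall xi, U xi -> `|c x xi - c y xi| <= e) ->
  `|Mop U c h x - Mop U c h y| <= e.
Proof.
move=> hK cxy; apply: (@sup_image_dist _ _ U U0 _ _ (Kc + K)) => [z Uz|z Uz|z Uz].
- exact: Mop_summand_le.
- exact: Mop_summand_le.
- by rewrite opprD addrACA subrr addr0 cxy.
Qed.

Lemma Mop_shift h (K s : R) x : (forall z, U z -> h z <= K) ->
  Mop U c (fun y => h y - s) x = Mop U c h x - s.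
Proof.
move=> hK; apply/eqP; rewrite eq_le; apply/andP; split.
  apply: Mop_le => xi Uxi; rewrite addrA lerD2r; exact: Mop_ge hK Uxi.
rewrite lerBlDr; apply: Mop_le => xi Uxi; rewrite -lerBlDr -addrA.
apply: (@Mop_ge _ (K - s)) => // z Uz; by rewrite lerD2r hK.
Qed.

(** Compactness of U makes the modulus in x uniform in the target. Near (x, xi), both c(y, xi') and
    c(x, xi') are compared with c(x, xi), hence the halves. *)
Lemma c_equicontinuous : compact U ->
  {within [set p : E * E | U p.2], continuous (fun p => c p.1 p.2)} ->
  forall x (e : R), 0 < e ->
    nbhs x [set y | forall xi, U xi -> `|c y xi - c x xi| <= e].
Proof.
move=> cU cc x e e0; have /compact_near_coveringP cUn := cU.
suff : \forall y \near x, U `<=` [set xi | U xi -> `|c y xi - c x xi| <= e].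
  by apply: filterS => y yU xi Uxi; exact: yU.
apply: (cUn _ (nbhs x) (fun y xi => U xi -> `|c y xi - c x xi| <= e)) => xi Uxi.
have e2 : 0 < e / 2 by rewrite divr_gt0.
have /cvgrPdist_le/(_ _ e2) H := cc (x, xi).
have Up : [set p : E * E | U p.2] (x, xi) by [].
have {H} : within [set p : E * E | U p.2] (nbhs (x, xi))
    [set p | `|c x xi - c p.1 p.2| <= e / 2].
  by rewrite (nbhs_subspace_in Up); exact: H.
move=> - [[V W]/= [Vx Wxi] VW].
exists (W, V) => //= - [xi' y]/= [Wxi' Vy] Uxi'.
have h1 := VW (y, xi') (conj Vy Wxi') Uxi'.
have h2 := VW (x, xi') (conj (nbhs_singleton Vx) Wxi') Uxi'.
move: h1 h2; rewrite /= !ler_norml => /andP[? ?] /andP[? ?]; apply/andP; split; lra.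
Qed.

End ImpulseOperator.

(** * Uniform limits along an ultrafilter *)

Section Ascoli.
Context {R : realType} {E : topologicalType}.

(** The values have a cluster point in a compact interval, and for an ultrafilter a cluster point is
    a limit. *)
Lemma bounded_ultra_cvg (F : set_system nat) (u : nat -> R) (K : R) :
  UltraFilter F -> (forall m, `|u m| <= K) -> exists l : R, u m @[m --> F] --> l.
Proof.
move=> FU uK; have FP : ProperFilter F by exact: ultra_proper.
have cK : compact `[- K, K]%classic by exact: segment_compact.
have [|l [_ cl]] := cK (u m @[m --> F]) _.
  by apply: nearW => m; rewrite /= in_itv/= -ler_norml.
exists l => V Vl; have [//|nV] := in_ultra_setVsetC (u @^-1` V) FU.
by have [z []] := cl (~` V) V nV Vl.
Qed.

(* Ascoli's theorem on the one-point compactification; an ultrafilter plays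
   the role of a uniformly convergent subsequence. *)
Lemma ascoli_ultra (G : nat -> E -> R) (K : R) :
  (forall m x, `|G m x| <= K) ->
  (forall x (e : R), 0 < e -> nbhs x [set y | forall m, `|G m y - G m x| <= e]) ->
  (forall e : R, 0 < e -> exists A : set E, compact A /\
     forall x y, ~ A x -> ~ A y -> forall m, `|G m x - G m y| <= e) ->
  exists (F : set_system nat) (g : E -> R),
    [/\ ProperFilter F, \oo `<=` F, continuous g &
      forall e : R, 0 < e -> \forall m \near F, forall x, `|G m x - g x| <= e].
Proof.
move=> GK Geq Ginf.
have [F [FU ooF]] := @ultraFilterLemma nat \oo _.
have FP : ProperFilter F by exact: ultra_proper.
have /choice[g cg] : forall x, exists l : R, G m x @[m --> F] --> l.
  by move=> x; apply: (@bounded_ultra_cvg F (fun m => G m x) K).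
have gdist x y (e : R) : (forall m, `|G m x - G m y| <= e) -> `|g x - g y| <= e.
  move=> Gxy; apply: cvgr_to_le (cvg_norm (cvgB (cg x) (cg y))) _; exact: nearW.
have near_pt x (e : R) : 0 < e -> \forall m \near F, `|G m x - g x| <= e.
  by move=> e0; have /cvgrPdist_le/(_ _ e0) := cg x; apply: filterS => m; rewrite distrC.
have tri m x y (e : R) : `|G m y - G m x| <= e / 3 -> `|g y - g x| <= e / 3 ->
    `|G m x - g x| <= e / 3 -> `|G m y - g y| <= e.
  by rewrite !ler_norml => /andP[? ?] /andP[? ?] /andP[? ?]; apply/andP; split; lra.
exists F, g; split => //.
  move=> x; apply/cvgrPdist_le => e e0; apply: filterS (Geq x e e0) => y Gy.
  by rewrite distrC; exact: gdist.
move=> e e0; have e3 : 0 < e / 3 by rewrite divr_gt0.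
have [A [cA HA]] := Ginf _ e3.
have nearA : \forall m \near F, A `<=` [set x | `|G m x - g x| <= e].
  have /compact_near_coveringP cAn := cA.
  apply: (cAn _ F (fun m x => `|G m x - g x| <= e)) => x Ax.
  exists ([set y | forall m, `|G m y - G m x| <= e / 3], [set m | `|G m x - g x| <= e / 3]).
    by split; [exact: Geq|exact: near_pt].
  by move=> [y m]/= [Gy Gm]; apply: (@tri m x) => //; exact: gdist.
(* [x0] plays the point at infinity: closeness at this one point spreads to the whole complement of
   A. If no such point exists, A covers E. *)
have [[x0 nAx0]|allA] := pselect (exists x0, ~ A x0).
  apply: filterS2 nearA (near_pt x0 _ e3) => m mA mx0 x.
  have [/mA//|nAx] := pselect (A x).
  by apply: (@tri m x0) => //; [exact: HA|apply: gdist; exact: HA].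
apply: filterS nearA => m mA x; apply: mA; apply: contrapT => nAx.
by apply: allA; exists x.
Qed.

End Ascoli.

(** * The one-step equation *)

Section Comparison.
Context {R : realType} {E : topologicalType} (e0 : E).
Notation bE := (@bmeas _ (borel_space e0) R).
Variables (Q : (E -> R) -> E -> R) (U : set E) (c : E -> E -> R) (Kc c0 delta : R).
Hypotheses
  (Qle : forall (g h : E -> R) x, bE g -> bE h -> (forall y, g y <= h y) ->
     Q g x <= Q h x)
  (QZ : forall a (h : E -> R) x, bE h -> Q (fun y => a * h y) x = a * Q h x)
  (U0 : U !=set0) (cK : forall x xi, U xi -> `|c x xi| <= Kc)
  (c0_lt0 : c0 < 0) (c_le : forall x xi, U xi -> c x xi <= c0) (delta_gt0 : 0 < delta).

(* Let rho = sup (W1 - W2). If lam2 < lam1, a running step improves the bound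
   W1 <= W2 + rho by kappa > 0; and only finitely many consecutive impulses can
   precede a running step, since each one costs at least -c0. *)
Lemma comparison (lam1 lam2 K : R) (B : set E) (W1 W2 : E -> R) :
  bE (fun y => expR (W1 y)) -> bE (fun y => expR (W2 y)) ->
  (forall x, `|W1 x| <= K) -> (forall x, `|W2 x| <= K) ->
  (forall x, (B x /\ expR (W1 x) = expR (- (lam1 * delta)) * Q (fun y => expR (W1 y)) x)
     \/ W1 x = Mop U c W1 x) ->
  (forall x, Mop U c W2 x <= W2 x) ->
  (forall x, B x -> expR (- (lam2 * delta)) * Q (fun y => expR (W2 y)) x <= expR (W2 x)) ->
  lam1 <= lam2.
Proof.
move=> b1 b2 W1K W2K H1 HM HQ; rewrite leNgt; apply/negP => l21.
pose kappa := (lam1 - lam2) * delta.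
have kappa0 : 0 < kappa by rewrite mulr_gt0// subr_gt0.
pose rho := sup (range (fun x => W1 x - W2 x)).
have W1le y : W1 y <= K by exact: le_trans (ler_norm _) (W1K y).
have W2le y : W2 y <= K by exact: le_trans (ler_norm _) (W2K y).
have rhoP x : W1 x <= W2 x + rho.
  rewrite -lerBlDl; apply: ub_le_sup; last by exists x.
  exists (K + K) => _ [y _ <-]; rewrite (le_trans (ler_norm _))//.
  by rewrite (le_trans (ler_normB _ _))// lerD.
have run x : B x -> expR (W1 x) = expR (- (lam1 * delta)) * Q (fun y => expR (W1 y)) x ->
    W1 x <= W2 x + rho - kappa.
  move=> Bx e1; rewrite -ler_expR e1.
  have b2' : bE (fun y => expR rho * expR (W2 y)) by exact: bmeasZ.
  have h : Q (fun y => expR (W1 y)) x <= expR rho * Q (fun y => expR (W2 y)) x.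
    rewrite -QZ//; apply: Qle => // y; rewrite -expRD ler_expR addrC; exact: rhoP.
  apply: (@le_trans _ _ (expR (rho - kappa) * (expR (- (lam2 * delta)) *
      Q (fun y => expR (W2 y)) x))).
    have -> : expR (rho - kappa) * (expR (- (lam2 * delta)) * Q (fun y => expR (W2 y)) x) =
        expR (- (lam1 * delta)) * (expR rho * Q (fun y => expR (W2 y)) x).
      rewrite !mulrA -!expRD; congr (expR _ * _); rewrite /kappa; ring.
    by rewrite ler_pM2l// expR_gt0.
  have -> : W2 x + rho - kappa = (rho - kappa) + W2 x by ring.
  rewrite [leRHS]expRD ler_pM2l ?expR_gt0//; exact: HQ.
have claim n x : W1 x <= Num.max (W2 x + rho - kappa) (K + n%:R * c0).
  elim: n x => [|n IH] x; first by rewrite mul0r addr0 le_max W1le orbT.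
  have [[Bx e1]|e1] := H1 x; first by rewrite le_max run.
  rewrite e1; apply: Mop_le => // xi Uxi; have := IH xi.
  rewrite !le_max => /orP[h|h]; apply/orP; [left|right].
    have := @Mop_ge _ _ U c Kc cK W2 K x xi (fun z _ => W2le z) Uxi.
    have := HM x; lra.
  have := c_le x Uxi; rewrite -natr1; lra.
have improved x : W1 x - W2 x <= rho - kappa.
  (* With this n, K + n c0 < - K - 1, so the second alternative of [claim] contradicts W1 >= - K. *)
  pose n := (Num.truncn ((2 * K + 1) / - c0)).+1.
  have : (2 * K + 1) / - c0 < n%:R by exact: truncnS_gt.
  rewrite ltr_pdivrMr ?oppr_gt0// mulrN => nc0.
  have := claim n x; rewrite le_max => /orP[|h]; first by lra.
  have := W1K x; rewrite ler_norml => /andP[h2 _]; lra.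
suff : rho <= rho - kappa by lra.
apply: ge_sup; first by exists (W1 e0 - W2 e0), e0.
by move=> _ [x _ <-].
Qed.

End Comparison.

Section OneStepEquation.
Context {R : realType} {E : topologicalType} (e0 : E) {d : measure_display}
  {Omega : measurableType d}.
Variables (P : E -> probability Omega R) (F : R -> set (set Omega))
  (X : R -> Omega -> E) (rho : E -> E -> R) (f : E -> R) (Kf : R).
Hypotheses (rhoP : metric_inducing rho) (HF : is_filtration F)
  (HA : adapted F X) (HC : cadlag_paths X) (HN : normal_process P X)
  (HS : strong_Markov P F X) (H2 : A2 P X)
  (fcont : continuous f) (f_le0 : forall x, f x <= 0)
  (f_norm : forall x, `|f x| <= Kf).
Variable delta : R.
Hypothesis delta_gt0 : 0 < delta.
Variables (U : set E) (c : E -> E -> R) (Kc : R).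
Hypotheses (U0 : U !=set0) (cK : forall x xi, U xi -> `|c x xi| <= Kc)
  (c_equi : forall x (e : R), 0 < e ->
     nbhs x [set y | forall xi, U xi -> `|c y xi - c x xi| <= e]).
Notation bE := (@bmeas _ (borel_space e0) R).
Local Notation Q := (Qop P X f delta).

Lemma Mop_continuous (h : E -> R) (K : R) : (forall z, U z -> h z <= K) ->
  continuous (Mop U c h).
Proof.
move=> hK x; apply/cvgrPdist_le => e e_gt0; apply: filterS (c_equi x e_gt0) => y cy.
by rewrite distrC; exact: (Mop_equi U0 cK hK cy).
Qed.

(** Off B the solution equals its impulse value, so the two indicator terms merge into [w (X delta)]
    and the equation becomes one for [Q]. As [Mop] commutes with subtracting a constant, the shift
    by [s] multiplies both sides by e^{-s}. *)
Lemma OS_value (B : set E) (w : E -> R) (lam s : R) : closed B -> U `<=` B ->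
  OS_solution P X delta f U c B w lam ->
  let W := fun x => w x - s in
  [/\ bE W, exists K, forall x, `|W x| <= K,
      forall x, ~ B x -> W x = Mop U c W x &
      forall x, B x -> expR (W x) = Num.max
        (expR (- (lam * delta)) * Q (fun y => expR (W y)) x) (expR (Mop U c W x))].
Proof.
move=> cB UB [wcont [K wK] woff won] W.
have wU z : U z -> `|w z| <= K by move=> /UB; exact: wK.
have wU' z : U z -> w z <= K by move=> /wU; apply: le_trans; exact: ler_norm.
have MK x : `|Mop U c w x| <= Kc + K.
  have [xi Uxi] := U0; rewrite ler_norml; apply/andP; split; last first.
    apply: Mop_le => // z Uz; exact: Mop_summand_le Uz.
  apply: le_trans (@Mop_ge _ _ U c Kc cK w K x xi wU' Uxi).
  have := cK x Uxi; have := wU xi Uxi; rewrite !ler_norml => /andP[? ?] /andP[? ?]; lra.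
have wbd x : `|w x| <= Kc + K + `|K|.
  have [Bx|nBx] := pselect (B x); last by rewrite woff// ler_wpDr.
  have Kc0 : 0 <= Kc by have [xi Uxi] := U0; exact: le_trans (cK x Uxi).
  have := wK x Bx; have := normr_ge0 K; have := normr_ge0 (w x); lra.
have mB : measurable (B : set (borel_space e0)) by exact: closed_borelE.
have bw : bE w.
  split; last by exists (Kc + K + `|K|).
  (* [w] may jump across the boundary of B; it is continuous on B and agrees off B with the
     continuous [Mop U c w]. *)
  rewrite -(setUv B); apply/(measurable_funU _ mB); first exact: measurableC.
  split; first exact: within_continuous_borel.
  have cM : continuous (Mop U c w) by exact: (@Mop_continuous w K).
  have mM : measurable_fun (~` B : set (borel_space e0)) (Mop U c w).
    apply: (@measurable_funS _ _ (borel_space e0) R setT _ _ measurableT) => //.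
    exact: (@continuous_borel R E e0 _ cM).
  apply: eq_measurable_fun mM => x; rewrite inE => nBx.
  by rewrite woff.
have bW : bE W by apply: bmeasB => //; exact: bmeas_cst.
have MW x : Mop U c W x = Mop U c w x - s by exact: (Mop_shift U0 cK s x wU').
split => //.
- by have [] := bW.
- by move=> x nBx; rewrite MW -woff.
move=> x Bx; rewrite MW.
have beW : bE (fun y => expR (W y)) by exact: bmeas_expR.
have bew : bE (fun y => expR (w y)) by exact: bmeas_expR.
have lin : Q (fun y => expR (W y)) x = expR (- s) * Q (fun y => expR (w y)) x.
  have -> : (fun y => expR (W y)) = (fun y => expR (- s) * expR (w y) + 0).
    by apply/funext => y; rewrite addr0 -expRD addrC.
  rewrite (@Qop_linear _ _ e0 _ _ P F X f Kf)//; [|exact: ltW|exact: bmeas_cst].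
  rewrite [X in _ + X = _](_ : _ = 0) ?addr0// /Qop.
  by rewrite -[RHS](mean_cst (P x)); congr (mean _ _); apply/funext => z; rewrite mulr0.
have Qw0 : 0 < expR (- (lam * delta)) * Q (fun y => expR (w y)) x.
  rewrite mulr_gt0 ?expR_gt0//.
  have Kf0 : 0 <= Kf by exact: le_trans (f_norm e0).
  apply: (@lt_le_trans _ _ (expR (- (Kf * delta)) * expR (- (Kc + K + `|K|)))).
    by rewrite mulr_gt0 ?expR_gt0.
  rewrite -[leLHS](mean_cst (P x)); apply: le_mean => [||z].
  - exact: bmeas_cst.
  - exact: (@bmeas_Q_integrand _ _ e0 _ _ F X f Kf HF HA HC fcont f_le0 f_norm _ _ (ltW delta_gt0) bew).
  - apply: ler_pM; rewrite ?expR_ge0// ler_expR.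
      have := @pathint_bounds _ _ _ _ X f Kf HC fcont f_le0 f_norm delta z (ltW delta_gt0).
      by move=> /andP[].
    by have := wbd (X delta z); rewrite ler_norml => /andP[].
have wx : expR (w x) = Num.max (expR (- (lam * delta)) * Q (fun y => expR (w y)) x)
    (expR (Mop U c w x)).
  rewrite won//.
  have -> : fine (Ex P x (fun om => expR (pathint X (fun y => f y - lam) delta om +
      \1_B (X delta om) * w (X delta om) +
      \1_(~` B) (X delta om) * Mop U c w (X delta om)))) =
      expR (- (lam * delta)) * Q (fun y => expR (w y)) x.
    rewrite /Qop -meanZ; last first.
      exact: (@bmeas_Q_integrand _ _ e0 _ _ F X f Kf HF HA HC fcont f_le0 f_norm _ _ (ltW delta_gt0) bew).
    congr (mean _ _); apply/funext => z.
    rewrite (@pathint_shift _ _ _ _ X f Kf HC fcont f_norm lam _ z (ltW delta_gt0)).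
    rewrite -!expRD; congr expR.
    have cases : \1_B (X delta z) * w (X delta z) +
        \1_(~` B) (X delta z) * Mop U c w (X delta z) = w (X delta z).
      rewrite !indicE; have [BX|nBX] := pselect (B (X delta z)).
        by rewrite mem_set// memNset ?mul1r ?mul0r ?addr0//; exact.
      by rewrite memNset// mem_set// mul1r mul0r add0r woff.
    by rewrite -[LHS]addrA cases; ring.
  have [ab|ab] := lerP (ln (expR (- (lam * delta)) * Q (fun y => expR (w y)) x)) (Mop U c w x).
    by rewrite max_r// -[leLHS]lnK ?posrE// ler_expR.
  by rewrite max_l ?lnK ?posrE// -[leRHS]lnK ?posrE// ler_expR ltW.
have -> : expR (W x) = expR (- s) * expR (w x) by rewrite -expRD addrC.
rewrite wx maxr_pMr ?expR_ge0// lin; congr (Num.max _ _); first by ring.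
by rewrite -expRD addrC.
Qed.

(* If the limit defining rf does not exist, its junk value is 0, which
   contradicts rf < l <= 0. *)
Lemma rf_tail (l : R) : rf P X f < l -> l <= 0 ->
  \forall N \near \oo, forall x, iter N Q (fun=> 1) x <= expR (l * (N%:R * delta)).
Proof.
pose S (t : R) := sup [set fine (Ex P x (fun w => expR (pathint X f t w))) | x in setT].
move=> rl l0; have cS : cvg (t^-1 * ln (S t) @[t --> +oo]).
  apply: contrapT => nc; move: rl; rewrite /rf dvgP//.
  by rewrite ltNge => /negP; apply.
have cS' : t^-1 * ln (S t) @[t --> +oo] --> rf P X f by exact: cS.
have ev : \forall t \near +oo, t^-1 * ln (S t) < l.
  by have /cvgr_lt := cS'; apply.
have [M [Mr HM]] := ev.
have : \forall N \near \oo, M < N%:R * delta.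
  exists (Num.truncn (`|M| / delta)).+1 => // N /= MN.
  rewrite -ltr_pdivrMr//; apply: (@le_lt_trans _ _ (`|M| / delta)).
    by rewrite ler_pM2r ?invr_gt0// ler_norm.
  by apply: lt_le_trans (truncnS_gt _) _; rewrite ler_nat.
apply: filterS2 (nbhs_infty_gt 0) => N N0 MN x.
have T0 : 0 < N%:R * delta by rewrite mulr_gt0// ltr0n.
have b1 : bE (fun=> 1) by exact: bmeas_cst.
have QE y : mean (P y) (fun w => expR (pathint X f (N%:R * delta) w)) = iter N Q (fun=> 1) y.
  rewrite -(@Qop_iter _ _ e0 _ _ P F X rho f Kf)//; congr (mean _ _).
  by apply/funext => w; rewrite mulr1.
have := HM _ MN; rewrite /= mulrC ltr_pdivrMr// => lnS.
have leS : iter N Q (fun=> 1) x <= S (N%:R * delta).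
  apply: ub_le_sup; last by exists x => //; exact: QE.
  exists 1 => _ [y _ <-]; rewrite [leLHS]QE -(@Qop_iter _ _ e0 _ _ P F X rho f Kf)//.
  apply: le_trans (ler_norm _) _.
  apply: (@Qop_norm _ _ e0 _ _ P F X f Kf) => //; first exact: ltW.
  by move=> z; rewrite normr1.
(* For S <= 0 the logarithm is a default value, and the sign of [expR] settles the case. *)
apply: le_trans leS _; have [S0|S0] := leP (S (N%:R * delta)) 0.
  exact: le_trans S0 (expR_ge0 _).
by rewrite -[leLHS]lnK ?posrE// ler_expR ltW.
Qed.

End OneStepEquation.

(** * Lipschitz bounds for the exponential and the logarithm *)

Lemma expR_dist_le {R : realType} (x y : R) : x <= 0 -> y <= 0 ->
  `|expR x - expR y| <= `|x - y|.
Proof.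
wlog xy : x y / x <= y => [H x0 y0|x0 y0].
  have [xy|/ltW yx] := leP x y; first exact: H.
  by rewrite distrC [leRHS]distrC; exact: H.
rewrite distrC [leRHS]distrC !ger0_norm ?subr_ge0 ?ler_expR//.
have -> : expR x = expR y * expR (x - y) by rewrite -expRD addrC subrK.
have h1 : 1 + (x - y) <= expR (x - y) by exact: expR_ge1Dx.
have h2 : expR (x - y) <= 1 by rewrite expR_le1 subr_le0.
have h3 : expR y <= 1 by rewrite expR_le1.
apply: (@le_trans _ _ (1 - expR (x - y))); last by lra.
rewrite -[X in X - _]mulr1 -mulrBr ler_piMl// subr_ge0//.
Qed.

Lemma ln_dist_le {R : realType} (x y K : R) : expR (- K) <= x -> expR (- K) <= y ->
  `|ln x - ln y| <= expR K * `|x - y|.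
Proof.
wlog xy : x y / x <= y => [H Kx Ky|Kx Ky].
  have [xy|/ltW yx] := leP x y; first exact: H.
  by rewrite distrC [`|x - y|]distrC; exact: H.
have x0 : 0 < x by exact: lt_le_trans (expR_gt0 _) Kx.
have y0 : 0 < y by exact: lt_le_trans x0 xy.
rewrite distrC [`|x - y|]distrC !ger0_norm ?subr_ge0 ?ler_ln ?posrE//.
rewrite -ln_div ?posrE//.
have -> : y / x = 1 + (y - x) / x by rewrite mulrBl mulfV ?lt0r_neq0// addrC subrK.
apply: (@le_trans _ _ ((y - x) / x)).
  rewrite -ler_expR lnK; first exact: expR_ge1Dx.
  by rewrite posrE ltr_wpDr// divr_ge0// ?subr_ge0// ltW.
rewrite mulrC ler_wpM2r ?subr_ge0//.
by rewrite -[leRHS]invrK -expRN lef_pV2 ?posrE ?expR_gt0.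
Qed.

(** * The limit of the normalised solutions and its stopping representation *)

Theorem theorem4p2 (R : realType) (E : topologicalType) (rho : E -> E -> R)
  (d : measure_display) (Omega : measurableType d)
  (P : E -> probability Omega R) (F : R -> set (set Omega)) (X : R -> Omega -> E)
  (f : E -> R) (c : E -> E -> R) (U : set E) (B : nat -> set E)
  (delta : R) (lam : nat -> R) (w : nat -> E -> R) :
  metric_inducing rho -> locally_compact_space (E := E) ->
  separable_space (E := E) ->
  standard_Feller_Markov P F X ->
  compact U -> U !=set0 ->
  (forall m, compact (B m)) -> U `<=` B 0%N ->
  (forall m, B m `<=` B m.+1) -> \bigcup_m B m = setT ->
  A1 f U c -> A2 P X -> A3 P X rho -> A4 P X B ->
  0 < delta ->
  (forall m, OS_solution P X delta f U c (B m) (w m) (lam m)) ->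
  rf P X f < limn lam ->
  exists wd : E -> R,
    [/\ Cb wd, sup [set wd xi | xi in U] = 0 &
        forall x : E, (wd x)%:E =
          ereal_sup [set (ln (fine (Ex P x
              (stopped_payoff X delta (limn lam) f U c wd tau))))%:E
            | tau in dyadic_stopping P F delta x]].
Proof.
move=> rhoP _ _ [[HF HA HC] HN _ [HS _ _]] cU U0 cB UB BS BT.
move=> [[fcont [Kf fK] f_le0] ccont [Kc cK] [c_le0 [c0 [c0_lt0 c0P]] c_inf]].
move=> H2 _ _ delta_gt0 OS rf_lt.
have [e0 Ue0] := U0.
have f_norm x : `|f x| <= Kf by exact: fK.
have Kc_ge0 : 0 <= Kc := le_trans (normr_ge0 _) (cK e0 e0 Ue0).
have c_le x xi : U xi -> c x xi <= c0 by move=> Uxi; have [] := c0P x xi xi Uxi Uxi.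
have c_equi := c_equicontinuous cU ccont.
have clB m : closed (B m) by exact: (rho_compact_closed rhoP).
have UBm m : U `<=` B m.
  by elim: m => // m IH; exact: subset_trans IH (BS m).
pose bE := @bmeas _ (borel_space e0) R.
pose Q := Qop P X f delta.
have dge0 := ltW delta_gt0.
have Qlin a (g h : E -> R) x : bE g -> bE h ->
    Q (fun y => a * g y + h y) x = a * Q g x + Q h x.
  exact: (@Qop_linear _ _ e0 _ _ P F X f Kf).
have Qle (g h : E -> R) x : bE g -> bE h -> (forall y, g y <= h y) -> Q g x <= Q h x.
  exact: (@le_Qop _ _ e0 _ _ P F X f Kf).
have Qnorm (h : E -> R) (K : R) x : bE h -> (forall y, `|h y| <= K) -> `|Q h x| <= K.
  exact: (@Qop_norm _ _ e0 _ _ P F X f Kf).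
have Qcvg (hn : nat -> E -> R) (h : E -> R) (K : R) x :
    (forall n, bE (hn n)) -> (forall n y, `|hn n y| <= K) ->
    (forall y, hn n y @[n --> \oo] --> h y) -> Q (hn n) x @[n --> \oo] --> Q h x.
  exact: (@Qop_cvg _ _ e0 _ _ P F X f Kf).
have QCb (h : E -> R) : bE h -> Cb (Q h).
  exact: (@Qop_Cb _ _ e0 _ _ P F X rho f Kf).
have QZ a (h : E -> R) x : bE h -> Q (fun y => a * h y) x = a * Q h x.
  exact: (@iterQZ _ _ e0 Q Qlin Qnorm QCb 1).
have b1 : bE (fun=> 1) by exact: bmeas_cst.
pose s m := sup [set w m xi | xi in U].
pose W m x := w m x - s m.
have osv m := @OS_value _ _ e0 _ _ P F X f Kf HF HA HC fcont f_le0 f_norm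
  delta delta_gt0 U c Kc U0 cK c_equi (B m) (w m) (lam m) (s m) (clB m) (UBm m) (OS m).
have bW m : bE (W m) by have [] := osv m.
have beW m : bE (fun y => expR (W m y)) := bmeas_expR (bW m).
have Woff m x : ~ B m x -> W m x = Mop U c (W m) x by have [_ _ + _] := osv m; exact.
have Won m x : B m x -> expR (W m x) = Num.max
    (expR (- (lam m * delta)) * Q (fun y => expR (W m y)) x) (expR (Mop U c (W m) x)).
  by have [_ _ _ +] := osv m; exact.
have MW m x : Mop U c (W m) x <= W m x.
  have [Bx|nBx] := pselect (B m x); last by rewrite [leRHS]Woff.
  by rewrite -ler_expR [leRHS]Won// le_max lexx orbT.
(* On B m, contained in B m.+1, the solution [W m.+1] dominates both its running value and its
   impulse value, as [comparison] asks of the second function. *)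
have lam_mono m : lam m <= lam m.+1.
  have [_ [K1 K1P]] := bW m; have [_ [K2 K2P]] := bW m.+1.
  apply: (@comparison _ _ e0 Q U c Kc c0 delta Qle QZ U0 cK c0_lt0 c_le delta_gt0
    (lam m) (lam m.+1) (Num.max K1 K2) (B m) (W m) (W m.+1) (beW m) (beW m.+1) _ _ _
    (MW m.+1)) => //.
  - by move=> x; rewrite le_max K1P.
  - by move=> x; rewrite le_max K2P orbT.
  - move=> x; have [Bx|nBx] := pselect (B m x); last by right; exact: Woff.
    have := Won m x Bx; case: lerP => _ h; last by left.
    by right; apply: expR_inj.
  - by move=> x /BS Bx; rewrite [leRHS]Won// le_max lexx.
have lam_le0 m : lam m <= 0.
  have [_ [K1 K1P]] := bW m.
  have K1_ge0 : 0 <= K1 by exact: le_trans (K1P e0).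
  apply: (@comparison _ _ e0 Q U c Kc c0 delta Qle QZ U0 cK c0_lt0 c_le delta_gt0
    (lam m) 0 K1 (B m) (W m) (fun=> 0) (beW m) (bmeas_expR (bmeas_cst 0))) => //.
  - by move=> x; rewrite normr0.
  - move=> x; have [Bx|nBx] := pselect (B m x); last by right; exact: Woff.
    have := Won m x Bx; case: lerP => _ h; last by left.
    by right; apply: expR_inj.
  - by move=> x; apply: Mop_le => // xi Uxi; rewrite addr0; exact: c_le0.
  - move=> x _; rewrite mul0r oppr0 !expR0 mul1r.
    by apply: le_trans (ler_norm _) _; apply: Qnorm => // y; rewrite normr1.
have lam_nd : {homo lam : n m / (n <= m)%N >-> n <= m} by apply/nondecreasing_seqP.
have lam_ub : has_ubound (range lam) by exists 0 => _ [m _ <-].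
have lam_cvg : lam m @[m --> \oo] --> limn lam by exact: nondecreasing_is_cvgn.
have lam_le m : lam m <= limn lam by exact: nondecreasing_cvgn_le.
set L := limn lam in rf_lt lam_cvg lam_le *.
have L_le0 : L <= 0 by apply: cvgr_to_le lam_cvg _; exact: nearW.
(* Two gaps are needed: rf < l bounds Q^N 1 by e^{l N delta}, and l < lam m0 makes q^N e^{l N delta}
   decay. Then q dominates [aL] and every [a m] with m >= m0. *)
pose l := (rf P X f + L) / 2.
have rfl : rf P X f < l by rewrite /l; lra.
have lL : l < L by rewrite /l; lra.
have [m0 lm0] : exists m0, l < lam m0.
  have /cvgr_gt/(_ _ lL)[m0 _ /(_ m0 (leqnn m0))] := lam_cvg; by exists m0.
pose a m := expR (- (lam m * delta)).
pose q := a m0.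
have q_gt0 : 0 < q by exact: expR_gt0.
have tail (eta : R) : 0 < eta -> exists N, forall x, q ^+ N * iter N Q (fun=> 1) x <= eta.
  move=> eta0; have l_le0 : l <= 0 by lra.
  have t1 := @rf_tail _ _ e0 _ _ P F X rho f Kf rhoP HF HA HC HN HS H2 fcont f_le0 f_norm
    delta delta_gt0 l rfl l_le0.
  have z0 : 0 < (lam m0 - l) * delta by rewrite mulr_gt0// subr_gt0.
  have t2 : \forall N \near \oo, expR (- ((lam m0 - l) * delta)) ^+ N <= eta.
    have : expR (- ((lam m0 - l) * delta)) ^+ n @[n --> \oo] --> (0 : R).
      by apply: cvg_expr; rewrite ger0_norm ?expR_ge0// expR_lt1 oppr_lt0.
    move=> /cvgrPdist_le/(_ _ eta0); apply: filterS => n.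
    by rewrite sub0r normrN => h; exact: le_trans (ler_norm _) h.
  have [N _ HN'] := filterI t1 t2.
  have [h1 h2] := HN' N (leqnn N).
  exists N => x; apply: le_trans h2.
  apply: (@le_trans _ _ (q ^+ N * expR (l * (N%:R * delta)))).
    by rewrite ler_pM2l ?exprn_gt0.
  rewrite /q /a -!expRM_natl -expRD ler_expR; lra.
have [C [C1 HCq]] := @subsolution_bound _ _ e0 Q Qlin Qle Qnorm QCb q q_gt0 tail.
pose aL := expR (- (L * delta)).
have aLq : aL <= q by rewrite ler_expR lerN2 ler_pM2r.
have aL_le m : aL <= a m by rewrite ler_expR lerN2 ler_pM2r.
have a_le_q m : (m0 <= m)%N -> a m <= q.
  by move=> m0m; rewrite ler_expR lerN2 ler_pM2r//; exact: lam_nd.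
have a_ge0 m : 0 <= a m by exact: expR_ge0.
have WU m x : U x -> W m x <= 0.
  move=> Ux; rewrite subr_le0; have [_ [K KP]] := bW m.
  apply: (@le_sup_image _ _ U (w m) (K + s m)) => // z Uz; rewrite -lerBlDr.
  exact: le_trans (ler_norm _) (KP z).
have supW m : sup [set W m xi | xi in U] = 0.
  apply/eqP; rewrite eq_le; apply/andP; split.
    by apply: (@sup_image_le _ _ U U0 (W m)) => z; exact: WU.
  suff : s m <= sup [set W m xi | xi in U] + s m by rewrite lerDr.
  apply: (@sup_image_le _ _ U U0 (w m)) => z Uz; rewrite -lerBlDr.
  by apply: (@le_sup_image _ _ U (W m) 0) => // y; exact: WU.
pose G m x := Mop U c (W m) x.
have G_le0 m x : G m x <= 0.
  by apply: (Mop_le U0) => xi Uxi; rewrite -[leRHS]addr0 lerD// ?c_le0// WU.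
(* The normalisation sup_U W m = 0 and c >= - Kc give a lower bound independent of m. *)
have G_ge m x : - Kc <= G m x.
  suff : 0 <= G m x + Kc by lra.
  rewrite -[leLHS](supW m); apply: (@sup_image_le _ _ U U0 (W m)) => xi Uxi.
  have := @Mop_ge _ _ U c Kc cK (W m) 0 x xi (WU m) Uxi.
  by have := cK x xi Uxi; rewrite ler_norml => /andP[+ _]; rewrite -/(G m x); lra.
have G_norm m x : `|G m x| <= Kc.
  by rewrite ler_norml G_ge (le_trans (G_le0 m x))//.
have [Fu [Gi [PFu ooFu cGi unif]]] : exists (Fu : set_system nat) (g : E -> R),
    [/\ ProperFilter Fu, \oo `<=` Fu, continuous g &
      forall e : R, 0 < e -> \forall m \near Fu, forall x, `|G m x - g x| <= e].
  apply: (@ascoli_ultra _ _ G Kc G_norm).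
    move=> x e e_gt0; apply: filterS (c_equi x e e_gt0) => y cy m.
    exact: (Mop_equi U0 cK (WU m) cy).
  move=> e e_gt0; have [A [cA HA']] := c_inf e e_gt0.
  exists A; split => // x y nAx nAy m.
  by apply: (Mop_equi U0 cK (WU m)); exact: HA'.
have Gi_near x e : 0 < e -> exists m, `|G m x - Gi x| <= e.
  by move=> e_gt0; have [m Hm] := filter_ex (unif e e_gt0); exists m.
have Gi_le0 x : Gi x <= 0.
  apply/ler_addgt0Pr => e e_gt0; have [m] := Gi_near x e e_gt0.
  by rewrite ler_norml => /andP[h1 h2]; have := G_le0 m x; lra.
have Gi_ge x : - Kc <= Gi x.
  apply/ler_addgt0Pr => e e_gt0; have [m] := Gi_near x e e_gt0.
  by rewrite ler_norml => /andP[h1 h2]; have := G_ge m x; lra.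
pose g x := expR (Gi x).
have g01 x : 0 <= g x <= 1 by rewrite /g expR_ge0 expR_le1 Gi_le0.
have g_ge x : expR (- Kc) <= g x by rewrite ler_expR.
have gC : Cb g.
  split; last by exists 1 => x _; have /andP[h1 h2] := g01 x; rewrite ger0_norm.
  by move=> x; apply: continuous_comp; [exact: cGi|exact: continuous_expR].
have [v [vC vE]] := @obstacle_solution _ _ e0 Q Qlin Qle Qnorm Qcvg QCb q q_gt0 tail
  aL g (expR_ge0 _) aLq gC g01.
have bv : bE v by exact: Cb_bmeas.
have bg : bE g by exact: Cb_bmeas.
have Kc_gt0 : 0 < expR (- Kc) by exact: expR_gt0.
have v_ge x : expR (- Kc) <= v x by rewrite vE le_max g_ge orbT.
have v_gt0 x : 0 < v x by exact: lt_le_trans (v_ge x).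
have Q_ge (h : E -> R) x : bE h -> (forall y, 0 <= h y) -> 0 <= Q h x.
  exact: (@Q_ge0 _ _ e0 Q Qle Qnorm QCb).
have sub_le (u : E -> R) (b : R) x : bE u -> (forall y, 0 <= u y) -> b <= q ->
    Num.max (b * Q u x) 1 <= q * Q u x + 1.
  move=> bu u0 bq; have Qu := Q_ge u x bu u0; rewrite ge_max; apply/andP; split.
    by rewrite ler_wpDr// ler_wpM2r.
  by rewrite lerDr mulr_ge0// ltW.
have v_le x : v x <= C.
  apply: HCq => // {}x; apply: le_trans (sub_le v aL x bv (fun y => ltW (v_gt0 y)) aLq).
  rewrite [leLHS]vE; have /andP[_ g1] := g01 x.
  by rewrite ge_max !le_max lexx g1 orbT.
have eW_ge m x : expR (- Kc) <= expR (W m x).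
  by rewrite ler_expR; exact: le_trans (G_ge m x) (MW m x).
(* From m0 on, a m <= q, so all these functions are subsolutions of one and the same inequality. *)
have eW_le m x : (m0 <= m)%N -> expR (W m x) <= C.
  move=> m0m; apply: (HCq (fun y => expR (W m y)) (beW m)) => {}x.
  apply: le_trans (sub_le (fun y => expR (W m y)) (a m) x (beW m) (fun y => expR_ge0 _)
    (a_le_q m m0m)).
  have [Bx|nBx] := pselect (B m x).
    by rewrite Won// ge_max !le_max lexx/= expR_le1 G_le0 orbT.
  by rewrite Woff// le_max expR_le1 G_le0 orbT.
have conv (eta : R) : 0 < eta ->
    \forall m \near Fu, forall x, U x -> `|expR (W m x) - v x| <= eta.
  move=> eta0.
  have [eps eps0 st] := @solution_stability _ _ e0 Q Qlin Qle Qnorm Qcvg QCb q q_gt0 tail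
    B U C eta clB BS BT cU UB C1 eta0.
  have a_cvg : \forall m \near \oo, a m - aL <= eps.
    have : a m @[m --> \oo] --> aL.
      apply: (cvg_comp _ expR); last exact: continuous_expR.
      by apply: cvgN; apply: cvgMl.
    move=> /cvgrPdist_le/(_ _ eps0); apply: filterS => m.
    by rewrite distrC => h; exact: le_trans (ler_norm _) h.
  have m0_near : \forall m \near \oo, (m0 <= m)%N by exists m0.
  have st' := ooFu _ st; have a_cvg' := ooFu _ a_cvg; have m0_near' := ooFu _ m0_near.
  have u' := unif _ eps0.
  apply: filterS2 (filterI st' a_cvg') (filterI m0_near' u') => m [stm am] [m0m um] x Ux.
  apply: (stm aL (a m) g (fun y => expR (G m y)) v (fun y => expR (W m y))) => //.
  - exact: expR_ge0.
  - exact: a_le_q.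
  - exact (beW m).
  - by move=> y; rewrite v_le ltW.
  - by move=> y; rewrite expR_ge0 eW_le.
  - move=> y; apply: le_trans (um y); exact: expR_dist_le.
  - by move=> y By; rewrite Won.
pose wd x := ln (v x).
have vwd x : v x = expR (wd x) by rewrite /wd lnK// posrE.
have conv_wd (e : R) : 0 < e -> \forall m \near Fu, forall x, U x -> `|W m x - wd x| <= e.
  move=> e_gt0; have e1 : 0 < e / expR Kc by rewrite divr_gt0// expR_gt0.
  apply: filterS (conv _ e1) => m Hm x Ux.
  rewrite -[W m x]expRK; apply: le_trans (ln_dist_le (eW_ge m x) (v_ge x)) _.
  by rewrite mulrC -ler_pdivlMr ?expR_gt0//; exact: Hm.
have lnC : 0 <= ln C by exact: ln_ge0.
have wd_le x : wd x <= ln C by rewrite ler_ln ?posrE//; lra.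
have W_le m z : U z -> W m z <= ln C by move=> /(WU m) h; exact: le_trans lnC.
(* Convergence on U suffices, because [Mop] reads its argument only there: the limit obstacle is the
   impulse value of [wd], which closes the fixed point. *)
have Mwd x : Mop U c wd x = Gi x.
  apply/eqP; rewrite -subr_eq0 -normr_le0; apply/ler_addgt0Pr => e e_gt0; rewrite add0r.
  have e2 : 0 < e / 2 by rewrite divr_gt0.
  have [m [h1 h2]] := filter_ex (filterI (conv_wd _ e2) (unif _ e2)).
  have := h2 x; have := @Mop_dist _ _ U c Kc U0 cK (W m) wd (ln C) (e / 2) x (W_le m)
    (fun z _ => wd_le z) h1.
  rewrite -/(G m x) !ler_norml => /andP[? ?] /andP[? ?]; apply/andP; split; lra.
exists wd; split.
- split; last first.
    exists (Kc + ln C) => x _; rewrite ler_norml; apply/andP; split; last first.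
      by apply: le_trans (wd_le x) _; rewrite lerDr.
    have : - Kc <= wd x by rewrite -[leLHS]expRK ler_ln ?posrE.
    by lra.
  move=> x; apply: continuous_comp; first exact: vC.1.
  exact: continuous_ln.
- apply/eqP; rewrite -normr_le0; apply/ler_addgt0Pr => e e_gt0; rewrite add0r.
  have [m Hm] := filter_ex (conv_wd _ e_gt0).
  have := @sup_image_dist _ _ U U0 wd (W m) (ln C) e (fun z _ => wd_le z) (W_le m).
  rewrite supW subr0; apply => z Uz; rewrite distrC; exact: Hm.
move=> x.
have payE tau : fine (Ex P x (stopped_payoff X delta L f U c wd tau)) =
    mean (P x) (payoff X f delta L g tau).
  congr (mean _ _); apply/funext => om; rewrite /stopped_payoff /payoff.
  case: (tau om) => // k; have k0 : 0 <= k%:R * delta by rewrite mulr_ge0.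
  rewrite (pathint_shift HC fcont f_norm L om k0) expRD Mwd; congr (_ * _).
  rewrite -expRM_natl -expRD; congr expR; ring.
apply/eqP; rewrite eq_le; apply/andP; split.
  apply/lee_addgt0Pr => e e_gt0.
  (* N is chosen so that truncation loses at most v x (1 - e^{-e}); the mean payoff is then at least
     v x e^{-e}, and its logarithm at least wd x - e. *)
  have v1e : 0 < v x * (1 - expR (- e)) / C.
    rewrite divr_gt0 ?mulr_gt0// ?subr_gt0 ?expR_lt1 ?oppr_lt0//; lra.
  have [N HN'] := tail _ v1e.
  pose tau := first_contact X delta v g N.
  have tauF : dyadic_stopping P F delta x tau.
    split.
      by move=> k; exact: (@first_contact_F _ _ e0 _ _ F X HF HA delta delta_gt0 v g bv bg N k).
    by exists N; exact: first_contact_dyadic.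
  rewrite -leeBlDr//; apply: le_trans (ereal_sup_ubound _); last first.
    by exists tau; [exact: tauF|reflexivity].
  rewrite payE -EFinB lee_fin.
  have := @mean_payoff_first_contact _ _ e0 _ _ P F X rho f Kf rhoP HF HA HC HN HS H2 fcont
    f_le0 f_norm delta L delta_gt0 v g (expR (- Kc)) bv bg Kc_gt0 g_ge vE N x C v_le.
  rewrite -/aL -/Q -/tau => hm.
  have hN : C * (aL ^+ N * iter N Q (fun=> 1) x) <= v x * (1 - expR (- e)).
    apply: (@le_trans _ _ (C * (q ^+ N * iter N Q (fun=> 1) x))).
      rewrite ler_wpM2l//; first lra.
      rewrite ler_wpM2r//; first exact: (@iterQ1_ge0 _ _ e0 Q Qle Qnorm QCb).
      by apply: lerXn2r; rewrite ?nnegrE ?expR_ge0.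
    by rewrite mulrC -ler_pdivlMr//; exact: lt_le_trans ltr01 C1.
  have hv : v x * expR (- e) <= mean (P x) (payoff X f delta L g tau) by lra.
  have ve0 : 0 < v x * expR (- e) by rewrite mulr_gt0 ?expR_gt0.
  have -> : wd x - e = ln (v x * expR (- e)) by rewrite lnM ?posrE ?expR_gt0// expRK.
  by rewrite ler_ln ?posrE//; exact: lt_le_trans hv.
apply: ub_ereal_sup => _ [tau [tauF [N tauN]] <-]; rewrite payE lee_fin.
have p0 := @mean_payoff_gt0 _ _ e0 _ _ P F X f Kf HF HA HC fcont f_le0 f_norm delta L
  delta_gt0 g (expR (- Kc)) bg Kc_gt0 g_ge tau tauF N x tauN.
rewrite ler_ln ?posrE//.
exact: (@mean_payoff_le _ _ e0 _ _ P F X rho f Kf rhoP HF HA HC HN HS H2 fcont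
  f_le0 f_norm delta L delta_gt0 v g (expR (- Kc)) bv bg Kc_gt0 g_ge vE tau tauF N x tauN).
Qed.
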